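(* For any $c>0$, there is an online factorization algorithm in the row arrival model such that, for any $m\times N$ real matrix $Q$ with rows $q_1,\ldots,q_m$, the algorithm achieves factorization value \[ \gamma = O\left(\gamma_2(Q)\log(\gamma_2(Q)/\|q_1\|_\infty)^{\frac12+c}\log(N)^3\right). \] Moreover, there is an online factorization algorithm in the column arrival model such that, for any $m\times N$ real matrix $A$, the algorithm achieves factorization value $\gamma = O(\gamma_2(A)\log(m)^3)$.
   Context: For a matrix, $\|R\|_{1\to2}$ is the maximum $\ell_2$ norm of a column, $\|L\|_{2\to\infty}$ the maximum $\ell_2$ norm of a row, $\|R\|_F$ the Frobenius norm, and $\gamma_2(A)=\min\{\|L\|_{2\to\infty}\|R\|_{1\to2}:LR=A\}$. Row arrival model: the rows $q_1,q_2,\ldots$ (row vectors in $\mathbb{R}^N$) of $Q$ arrive one at a time, and the number of rows $m$ is not known to the algorithm. The algorithm chooses an initial (possibly empty) matrix $R_0$ with $N$ columns. At step $t$, after receiving $q_t$, it forms $R_t$ by appending rows to $R_{t-1}$, and outputs a row vector $\ell_t$ (of dimension equal to the number of rows of $R_t$) with $\ell_tR_t=q_t$. It must hold that $\|R_t\|_{1\to2}\le1$ for all $t$. $L_t$ denotes the matrix with rows $\ell_1,\ldots,\ell_t$ padded with zeros, so $L_tR_t=Q_t$, the matrix of the first $t$ rows. The algorithm achieves factorization value $\gamma$ if $\max_t\|\ell_t\|_2\le\gamma$. Column arrival model: the columns $a_1,a_2,\ldots\in\mathbb{R}^m$ of $A$ arrive one at a time. The algorithm chooses an initial (possibly empty)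 matrix $L_0$ with $m$ rows; at step $t$ it forms $L_t$ by appending columns to $L_{t-1}$ and outputs a column vector $r_t$ with $L_tr_t=a_t$ and $\|r_t\|_2\le1$ (so the matrix $R_t$ of zero-padded columns $r_1,\ldots,r_t$ satisfies $L_tR_t=A_t$, $\|R_t\|_{1\to2}\le 1$). The factorization value is $\gamma=\|L_N\|_{2\to\infty}$, where $N$ is the total number of columns.
   Formalization: Each logarithm log x in the bounds is read as 1 + ln x, since the bounds would otherwise be 0 (and false) for N = 1, m = 1 or γ_2(Q) = ‖q_1‖_∞; the first bound is stated for q_1 ≠ 0, where the ratio γ_2(Q)/‖q_1‖_∞ is defined. *)

(* Defs.v *)
From HB Require Import structures.
From mathcomp Require Import all_boot all_order all_algebra.
From mathcomp Require Import classical_sets reals exp.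
Set Implicit Arguments. Unset Strict Implicit. Unset Printing Implicit Defensive.
Import Order.TTheory GRing.Theory Num.Theory.
Local Open Scope ring_scope.

Section Norms.
Variable R : realType.

Definition rnorm2 n (v : 'rV[R]_n) : R := Num.sqrt (\sum_(j < n) v 0 j ^+ 2).
Definition cnorm2 n (v : 'cV[R]_n) : R := Num.sqrt (\sum_(i < n) v i 0 ^+ 2).

Definition norm_2inf m n (L : 'M[R]_(m, n)) : R :=
  \big[Num.max/0]_(i < m) rnorm2 (row i L).
Definition norm_12 m n (M : 'M[R]_(m, n)) : R :=
  \big[Num.max/0]_(j < n) cnorm2 (col j M).
Definition rnorm_inf n (v : 'rV[R]_n) : R := \big[Num.max/0]_(j < n) `|v 0 j|.

Definition gamma2 m n (A : 'M[R]_(m, n)) : R :=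
  inf [set x : R | exists (k : nat) (L : 'M[R]_(m, k)) (M : 'M[R]_(k, n)),
         L *m M = A /\ x = norm_2inf L * norm_12 M].

Definition mx_of_rows N (s : seq 'rV[R]_N) : 'M[R]_(size s, N) :=
  \matrix_(i < size s, j < N) (nth 0 s i) 0 j.
Definition mx_of_cols m (s : seq 'cV[R]_m) : 'M[R]_(m, size s) :=
  \matrix_(i < m, j < size s) (nth 0 s j) i 0.
Definition rv_of_seq n (l : seq R) : 'rV[R]_n := \row_(i < n) nth 0 l i.
Definition cv_of_seq n (l : seq R) : 'cV[R]_n := \col_(i < n) nth 0 l i.

(* Row arrival model (N columns known, number of rows unknown).
   A deterministic online algorithm is given by an initial list of rows R_0
   and a step function: on the history [q_1;...;q_t] it returns the rows it
   appends to R_{t-1} (giving R_t) and the coefficient vector l_t. *)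
Record row_alg (N : nat) := RowAlg {
  ra_init : seq 'rV[R]_N;
  ra_step : seq 'rV[R]_N -> seq 'rV[R]_N * seq R }.

Definition ra_R N (A : row_alg N) (qs : seq 'rV[R]_N) (t : nat) : seq 'rV[R]_N :=
  ra_init A ++ flatten [seq (ra_step A (take s qs)).1 | s <- iota 1 t].
Definition ra_l N (A : row_alg N) (qs : seq 'rV[R]_N) (t : nat) : seq R :=
  (ra_step A (take t qs)).2.

Definition row_alg_valid N (A : row_alg N) : Prop :=
  forall (qs : seq 'rV[R]_N) (t : nat), (1 <= t <= size qs)%N ->
    let Rt := ra_R A qs t in
    [/\ size (ra_l A qs t) = size Rt,
        rv_of_seq (size Rt) (ra_l A qs t) *m mx_of_rows Rt = nth 0 qs t.-1
      & norm_12 (mx_of_rows Rt) <= 1].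

Definition row_alg_achieves N (A : row_alg N) (qs : seq 'rV[R]_N) (g : R) : Prop :=
  forall t : nat, (1 <= t <= size qs)%N ->
    rnorm2 (rv_of_seq (size (ra_R A qs t)) (ra_l A qs t)) <= g.

(* Column arrival model (m rows known, number of columns unknown).
   Initial list of columns L_0; on history [a_1;...;a_t] the step returns the
   columns appended to L_{t-1} (giving L_t) and r_t. *)
Record col_alg (m : nat) := ColAlg {
  ca_init : seq 'cV[R]_m;
  ca_step : seq 'cV[R]_m -> seq 'cV[R]_m * seq R }.

Definition ca_L m (A : col_alg m) (as_ : seq 'cV[R]_m) (t : nat) : seq 'cV[R]_m :=
  ca_init A ++ flatten [seq (ca_step A (take s as_)).1 | s <- iota 1 t].
Definition ca_r m (A : col_alg m) (as_ : seq 'cV[R]_m) (t : nat) : seq R :=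
  (ca_step A (take t as_)).2.

Definition col_alg_valid m (A : col_alg m) : Prop :=
  forall (as_ : seq 'cV[R]_m) (t : nat), (1 <= t <= size as_)%N ->
    let Lt := ca_L A as_ t in
    [/\ size (ca_r A as_ t) = size Lt,
        mx_of_cols Lt *m cv_of_seq (size Lt) (ca_r A as_ t) = nth 0 as_ t.-1
      & cnorm2 (cv_of_seq (size Lt) (ca_r A as_ t)) <= 1].

Definition col_alg_value m (A : col_alg m) (as_ : seq 'cV[R]_m) : R :=
  norm_2inf (mx_of_cols (ca_L A as_ (size as_))).

(* logarithm convention for O(.)-bounds: log+ x = 1 + ln x (used for x >= 1) *)
Definition logp (x : R) : R := 1 + ln x.

End Norms.

(* Main.v *)
(** Everything is phrased dually: rows [s] cover [q] at cost [c] when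
    [<q, w>^2 <= c * \sum_(r <- s) <r, w>^2] for all [w], which is equivalent to
    [q] being a combination of [s] with squared coefficient norm at most [c].

    Suppose the arriving [q] all satisfy [<q, w>^2 <= 4 |M w|^2] for an unknown [M]
    with columns of norm at most 1.  Keep a working matrix [X = \sum_k 2^k P_k] with
    mutually orthogonal projections [P_k] of sum 1, starting from [X = 1].  If some
    [|P_k q|^2] exceeds [2^k], move the direction [v] of [P_k q] from level [k] to
    level [k + 1], that is, add [2^k v v^T] to [X].  Then
    [2^k < <q, v>^2 <= 4 |M v|^2], while [\sum_k k tr(M P_k M^T)] increases by exactly
    [|M v|^2] and stays below [L |M|_F^2]; so the trace of [X] on any coordinate set
    is at most [O(log N)] times its size, and [q] is covered at cost [O(log N)].

    To control the diagonal instead of the trace, a coordinate is frozen once its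
    diagonal entry exceeds [K = O(log N)], and later increments are masked there.
    At most half of the coordinates freeze, and they are passed to a second copy of
    the procedure, and so on through [O(log N)] copies.  The old rows masked by the
    current frozen set are recovered from the rows masked when they were created by
    subtracting restrictions to blocks of coordinates frozen during the intervals of
    a Fenwick tree over the step counter, which costs [O(log N)] in the cover and in
    the diagonal.  Altogether, the product of cover cost and diagonal is [O(log^6 N)].

    Finally, [gamma_2] of the rows seen so far is guessed by doubling; a new guess
    starts a fresh run.  In the row model the i-th run gets the share
    [(i+1)^(-2c) - (i+2)^(-2c)] of the unit column budget; in the column model the
    runs are scaled by their guesses, whose squares form a geometric series. *)

Require Import Defs.
From HB Require Import structures.
From mathcomp Require Import classical_sets reals sequences exp boolp.
From mathcomp Require Import all_boot all_order all_algebra.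
From mathcomp Require Import ring lra zify.
Set Implicit Arguments. Unset Strict Implicit. Unset Printing Implicit Defensive.
Import Order.TTheory GRing.Theory Num.Theory.
Local Open Scope ring_scope.

(** * Covering by rows *)


Section DotProduct.
Variable R : realType.

Definition dot n (u v : 'rV[R]_n) : R := (u *m v^T) 0 0.

Lemma dotE n (u v : 'rV_n) : dot u v = \sum_j u 0 j * v 0 j.
Proof. by rewrite /dot mxE; apply: eq_bigr => j _; rewrite mxE. Qed.

Lemma dotC n (u v : 'rV_n) : dot u v = dot v u.
Proof. by rewrite !dotE; apply: eq_bigr => j _; rewrite mulrC. Qed.

Lemma dotDl n (u1 u2 v : 'rV_n) : dot (u1 + u2) v = dot u1 v + dot u2 v.
Proof. by rewrite /dot mulmxDl mxE. Qed.

Lemma dotDr n (u v1 v2 : 'rV_n) : dot u (v1 + v2) = dot u v1 + dot u v2.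
Proof. by rewrite !(dotC u) dotDl. Qed.

Lemma dotZl n a (u v : 'rV_n) : dot (a *: u) v = a * dot u v.
Proof. by rewrite /dot -scalemxAl mxE. Qed.

Lemma dotZr n a (u v : 'rV_n) : dot u (a *: v) = a * dot u v.
Proof. by rewrite dotC dotZl dotC. Qed.

Lemma dotNl n (u v : 'rV_n) : dot (- u) v = - dot u v.
Proof. by rewrite -scaleN1r dotZl mulN1r. Qed.

Lemma dotBl n (u1 u2 v : 'rV_n) : dot (u1 - u2) v = dot u1 v - dot u2 v.
Proof. by rewrite dotDl dotNl. Qed.

Lemma dot0l n (v : 'rV_n) : dot 0 v = 0.
Proof. by rewrite /dot mul0mx mxE. Qed.

Lemma dot_suml n I (s : seq I) (F : I -> 'rV_n) v :
  dot (\sum_(i <- s) F i) v = \sum_(i <- s) dot (F i) v.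
Proof. by rewrite /dot mulmx_suml summxE. Qed.

Lemma dot_mulr m n (u : 'rV_m) (A : 'M_(m, n)) v :
  dot (u *m A) v = dot u (v *m A^T).
Proof. by rewrite /dot trmx_mul trmxK mulmxA. Qed.

Lemma dot_ge0 n (u : 'rV_n) : 0 <= dot u u.
Proof. by rewrite dotE sumr_ge0 // => j _; rewrite -expr2 sqr_ge0. Qed.

Lemma dot_eq0 n (u : 'rV_n) : dot u u = 0 -> u = 0.
Proof.
rewrite dotE => u0; apply/rowP => j; rewrite mxE.
have /psumr_eq0P/(_ u0 j isT)/eqP : forall i, true -> 0 <= u 0 i * u 0 i.
  by move=> i _; rewrite -expr2 sqr_ge0.
by rewrite mulf_eq0 orbb => /eqP.
Qed.

Lemma dot_delta n (u : 'rV_n) j : dot u (delta_mx 0 j) = u 0 j.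
Proof.
rewrite dotE (bigD1 j) //= mxE !eqxx mulr1 big1 ?addr0 // => i ij.
by rewrite mxE (negPf ij) andbF mulr0.
Qed.

Lemma dot_CS n (u v : 'rV_n) : dot u v ^+ 2 <= dot u u * dot v v.
Proof.
have [v0|vN0] := eqVneq (dot v v) 0.
  by rewrite (dot_eq0 v0) dotC !dot0l expr0n /= mulr0.
have vp : 0 < dot v v by rewrite lt_def vN0 dot_ge0.
have := dot_ge0 (dot v v *: u - dot u v *: v).
rewrite -scaleNr dotDl !dotDr !(dotZl, dotZr) (dotC v u).
set a := dot u u; set b := dot v v; set c := dot u v => h.
have {h} : 0 <= b * (a * b - c ^+ 2) by nra.
by rewrite pmulr_rge0 // subr_ge0.
Qed.

Lemma sqr_sum_le (I : Type) (s : seq I) (a : I -> R) :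
  (\sum_(i <- s) a i) ^+ 2 <= (size s)%:R * \sum_(i <- s) a i ^+ 2.
Proof.
elim: s => [|i s IH]; first by rewrite !big_nil expr0n mul0r.
rewrite !big_cons /= -natr1.
set x := \sum_(j <- s) a j in IH *; set y := \sum_(j <- s) a j ^+ 2 in IH *.
have [s0|sN0] := posnP (size s).
  have x0 : x = 0 by rewrite /x (size0nil s0) big_nil.
  have y0 : y = 0 by rewrite /y (size0nil s0) big_nil.
  by rewrite x0 y0 s0; lra.
have n0 : 0 < (size s)%:R :> R by rewrite ltr0n.
move: IH; set n := (size s)%:R in n0 * => IH.
have h := sqr_ge0 (n * a i - x).
have : 0 <= n * ((n + 1) * (a i ^+ 2 + y) - (a i + x) ^+ 2) by nra.
by rewrite pmulr_rge0 // subr_ge0.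
Qed.

Definition qform n (s : seq 'rV[R]_n) (w : 'rV_n) : R :=
  \sum_(r <- s) dot r w ^+ 2.

Lemma qform_ge0 n (s : seq 'rV_n) w : 0 <= qform s w.
Proof. by rewrite sumr_ge0 // => r _; rewrite sqr_ge0. Qed.

Lemma qform_cat n (s t : seq 'rV_n) w : qform (s ++ t) w = qform s w + qform t w.
Proof. by rewrite /qform big_cat. Qed.

Lemma qform_cons n r (s : seq 'rV_n) w : qform (r :: s) w = dot r w ^+ 2 + qform s w.
Proof. by rewrite /qform big_cons. Qed.

Lemma qform_nil n (w : 'rV_n) : qform [::] w = 0.
Proof. by rewrite /qform big_nil. Qed.

Lemma qform_scale n a (s : seq 'rV_n) w :
  qform [seq a *: r | r <- s] w = a ^+ 2 * qform s w.
Proof.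
rewrite /qform big_map mulr_sumr; apply: eq_bigr => r _.
by rewrite dotZl exprMn.
Qed.

Lemma qform_flatten n (I : Type) (s : seq I) (F : I -> seq 'rV_n) w :
  qform (flatten [seq F i | i <- s]) w = \sum_(i <- s) qform (F i) w.
Proof. by rewrite /qform big_flatten big_map. Qed.

Lemma qform_mul n (s : seq 'rV_n) (A : 'M_n) w :
  qform [seq r *m A | r <- s] w = qform s (w *m A^T).
Proof. by rewrite /qform big_map; apply: eq_bigr => r _; rewrite dot_mulr. Qed.

Lemma qformN n (s : seq 'rV_n) w : qform s (- w) = qform s w.
Proof. by apply: eq_bigr => r _; rewrite dotC dotNl sqrrN dotC. Qed.

(** Weighted Cauchy-Schwarz, [(a + b)^2 <= (h + 1) (a^2 + b^2 / h)]: one more piece on top of [h]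
    pieces raises the factor by one only, so chains cost linearly. For [h = 0] the form vanishes at
    [w2]. *)
Lemma qform_add n (s : seq 'rV_n) w1 w2 (h : nat) y : 0 <= y ->
  qform s w2 <= h%:R * y -> qform s (w1 + w2) <= h.+1%:R * (qform s w1 + y).
Proof.
move=> y0; have [-> | h0] := posnP h.
  rewrite mul0r mul1r => s0.
  rewrite -[leLHS]addr0; apply: lerD => //.
  elim: s s0 => [|r s IH]; first by rewrite !qform_nil.
  rewrite !qform_cons => s0.
  have [p1 p2] := (sqr_ge0 (dot r w2), qform_ge0 s w2).
  have /eqP : dot r w2 ^+ 2 = 0 by lra.
  rewrite sqrf_eq0 dotDr => /eqP ->; rewrite addr0 lerD2l IH //; lra.
move=> hy; have {}h0 : 0 < h%:R :> R by rewrite ltr0n.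
have key : h%:R * qform s (w1 + w2)
    <= h%:R * h.+1%:R * qform s w1 + h.+1%:R * qform s w2.
  rewrite /qform !mulr_sumr -big_split /=; apply: ler_sum => r _.
  rewrite dotC dotDl (dotC w1) (dotC w2) -natr1.
  by have := sqr_ge0 (h%:R * dot r w1 - dot r w2); nra.
rewrite -(ler_pM2l h0); apply: le_trans key _.
by rewrite -natr1 in hy *; nra.
Qed.

(** * Restriction to sets of coordinates *)

Definition res n (B : {set 'I_n}) : 'M[R]_n := diag_mx (\row_j (j \in B)%:R).

Lemma mul_resE n (w : 'rV_n) B j : (w *m res B) 0 j = if j \in B then w 0 j else 0.
Proof. by rewrite mul_mx_diag !mxE; case: ifP; rewrite ?mulr1 ?mulr0. Qed.

Lemma tr_res n (B : {set 'I_n}) : (res B)^T = res B.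
Proof. by rewrite /res tr_diag_mx. Qed.

Lemma res_mul n (A B : {set 'I_n}) : res A *m res B = res (A :&: B).
Proof.
rewrite /res mulmx_diag; congr diag_mx; apply/rowP => j.
by rewrite !mxE inE -natrM mulnb.
Qed.

Lemma res_setT n : res [set: 'I_n] = 1%:M.
Proof.
rewrite -diag_const_mx; congr diag_mx; apply/rowP => j.
by rewrite !mxE inE.
Qed.

Lemma res_set0 n : res (set0 : {set 'I_n}) = 0.
Proof.
rewrite /res (_ : (\row_j _) = 0) ?linear0 //; apply/rowP => j.
by rewrite !mxE inE.
Qed.

Lemma mul_res_sub n (A B : {set 'I_n}) : A \subset B -> res A *m res B = res A.
Proof. by move=> /setIidPl AB; rewrite res_mul AB. Qed.

Lemma res_setD n (A B : {set 'I_n}) : A \subset B -> res (B :\: A) = res B - res A.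
Proof.
move=> AB; rewrite /res -linearB; congr diag_mx; apply/rowP => j.
rewrite !mxE inE; have := subsetP AB j.
by case: (j \in A) => [-> //|_]; rewrite ?subrr ?subr0 //.
Qed.

Lemma res_setC n (B : {set 'I_n}) : res (~: B) = 1%:M - res B.
Proof. by rewrite -setTD res_setD ?subsetT // res_setT. Qed.

Lemma delta_res n (B : {set 'I_n}) j :
  delta_mx 0 j *m res B = if j \in B then delta_mx 0 j else 0 :> 'rV_n.
Proof.
apply/rowP => i; rewrite mul_resE.
have [-> | ij] := eqVneq i j; first by case: ifP => _; rewrite ?mxE.
by case: (j \in B); case: (i \in B); rewrite ?mxE ?(negPf ij) ?andbF.
Qed.

Lemma qform_res n (s : seq 'rV_n) B w :
  qform [seq r *m res B | r <- s] w = qform s (w *m res B).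
Proof. by rewrite qform_mul tr_res. Qed.

End DotProduct.

(** * Levels of orthogonal projections *)


Section Projections.
Variables (R : realType) (N L : nat).
Implicit Types (l : seq (nat * 'rV[R]_N)) (v w : 'rV[R]_N) (B : {set 'I_N}).

(** The list [l] records the moves, newest first: [(i, v)] takes direction [v] from level [i] to
    level [i + 1], and [proj l k] is the resulting [P_k]. *)
Fixpoint proj l (k : nat) : 'M[R]_N :=
  if l is (i, v) :: l' then
    proj l' k + ((k == i.+1)%:R - (k == i)%:R) *: (v^T *m v)
  else if k == 0%N then 1%:M else 0.

Fixpoint valid l : Prop :=
  if l is (i, v) :: l' then
    [/\ valid l', (i < L)%N, dot v v = 1 & v *m proj l' i = v]
  else True.

Lemma tr_proj l k : (proj l k)^T = proj l k.
Proof.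
elim: l => [|[i v] l IH] /=; first by case: ifP => _; rewrite ?trmx1 ?trmx0.
by rewrite linearD linearZ /= IH trmx_mul trmxK.
Qed.

(** Idempotence and mutual orthogonality need one joint induction: validity makes [v P_a] equal to
    [v] at the level of [v] and to 0 elsewhere, so a move merely transfers the rank-one projection
    [v^T v]. *)
Lemma proj_mul l i j : valid l ->
  proj l i *m proj l j = if i == j then proj l i else 0.
Proof.
elim: l i j => [|[k v] l IH] i j /=.
  move=> _; case: (i =P 0%N) => [->|i0].
    by rewrite mul1mx eq_sym.
  by rewrite mul0mx if_same.
case=> lv kL v1 vk; have {}IH i j := IH i j lv.
have vP a : v *m proj l a = if a == k then v else 0.
  by rewrite -{1}vk -mulmxA IH (eq_sym a); case: ifP => _; rewrite ?vk ?mulmx0.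
have Pv a : proj l a *m v^T = if a == k then v^T else 0.
  by rewrite -[LHS]trmxK trmx_mul trmxK tr_proj vP; case: ifP; rewrite ?trmx0.
have vv : v *m v^T = 1%:M.
  by apply/matrixP => a b; rewrite !ord1 [RHS]mxE; apply: v1.
set Q := v^T *m v.
have QQ : Q *m Q = Q by rewrite /Q mulmxA -(mulmxA v^T) vv mulmx1.
have PQ a : proj l a *m Q = (a == k)%:R *: Q.
  by rewrite /Q mulmxA Pv; case: ifP; rewrite ?mul0mx ?scale1r ?scale0r.
have QP a : Q *m proj l a = (a == k)%:R *: Q.
  by rewrite /Q -mulmxA vP; case: ifP; rewrite ?mulmx0 ?scale1r ?scale0r.
rewrite mulmxDl !mulmxDr IH -!scalemxAl -!scalemxAr QQ PQ QP !scalerA.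
rewrite -addrA -!scalerDl.
have [-> | ij] := eqVneq i j.
  congr (_ + _ *: _); have [-> | jk] := eqVneq j k.
    by rewrite ?eqxx (ltn_eqF (ltnSn k)) /=; ring.
  by case: eqP => _ /=; ring.
rewrite add0r; rewrite [X in X *: _](_ : _ = 0) ?scale0r //.
have [ik | ik] := eqVneq i k; have [jk | jk] := eqVneq j k.
- by move: ij; rewrite ik jk eqxx.
- by rewrite ik ?eqxx (ltn_eqF (ltnSn k)); case: eqP => _ /=; ring.
- by rewrite jk ?eqxx (ltn_eqF (ltnSn k)); case: eqP => _ /=; ring.
case: (i =P k.+1) => [ik1|_]; case: (j =P k.+1) => [jk1|_] /=; try ring.
by move: ij; rewrite ik1 jk1 eqxx.
Qed.

(** The effect of one move on a weighted sum of levels; used with the weights [1], [2 ^ k] and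
    [k]. *)
Lemma sum_level (V : lmodType R) (a : nat -> R) (i : nat) (x : V) : (i < L)%N ->
  \sum_(k < L.+1) (a k * ((k == i.+1 :> nat)%:R - (k == i :> nat)%:R)) *: x
  = (a i.+1 - a i) *: x.
Proof.
move=> iL; rewrite -scaler_suml; congr (_ *: _).
under eq_bigr do rewrite mulrBr.
rewrite sumrB (bigD1 (Ordinal (iL : (i.+1 < L.+1)%N))) //= eqxx mulr1 big1 ?addr0.
  rewrite (bigD1 (Ordinal (ltnW iL : (i < L.+1)%N))) //= eqxx mulr1 big1 ?addr0 //.
  by move=> k /negPf; rewrite -val_eqE /= => ->; rewrite mulr0.
by move=> k /negPf; rewrite -val_eqE /= => ->; rewrite mulr0.
Qed.

Lemma sum_proj l : valid l -> \sum_(k < L.+1) proj l k = 1%:M.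
Proof.
elim: l => [|[i v] l IH] /=.
  by move=> _; rewrite big_ord_recl /= big1 ?addr0.
case=> lv iL _ _; rewrite big_split /= IH //.
under [X in _ + X]eq_bigr do rewrite -[X in X *: _]mul1r.
by rewrite (sum_level (fun=> 1)) // subrr scale0r addr0.
Qed.

Lemma dot_proj l k w u : valid l -> dot (w *m proj l k) u = dot (w *m proj l k) (u *m proj l k).
Proof.
by move=> lv; rewrite [RHS]dot_mulr tr_proj -mulmxA proj_mul // eqxx dot_mulr tr_proj.
Qed.

Fixpoint raw l : seq 'rV[R]_N :=
  if l is (i, v) :: l' then Num.sqrt (2 ^+ i) *: v :: raw l'
  else [seq delta_mx 0 j | j <- enum 'I_N].

Lemma qform_basis w : qform [seq delta_mx 0 j | j <- enum 'I_N] w = dot w w.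
Proof.
rewrite /qform big_map big_enum /= dotE; apply: eq_bigr => j _.
by rewrite dotC dot_delta expr2.
Qed.

(** A move adds [2^(i+1) - 2^i = 2^i] times the projection on [v], which is the Gram matrix of the
    new row of [raw]; thus [raw l] has Gram matrix [X]. *)
Lemma qform_raw l w : valid l ->
  qform (raw l) w =
  \sum_(k < L.+1) 2 ^+ k * dot (w *m proj l k) (w *m proj l k).
Proof.
move=> lv; have -> : \sum_(k < L.+1) 2 ^+ k * dot (w *m proj l k) (w *m proj l k)
    = \sum_(k < L.+1) 2 ^+ k * dot (w *m proj l k) w.
  by apply: eq_bigr => k _; rewrite -dot_proj.
elim: l lv => [|[i v] l IH] /=.
  move=> _; rewrite qform_basis big_ord_recl /= big1 ?addr0 ?mulmx1 ?mul1r //.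
  by move=> k _; rewrite mulmx0 dot0l mulr0.
case=> lv iL v1 vk; rewrite qform_cons IH // dotZl exprMn sqr_sqrtr ?exprn_ge0 //.
under [RHS]eq_bigr do rewrite mulmxDr -scalemxAr dotDl dotZl mulrDr mulrA.
rewrite big_split /= addrC; congr (_ + _).
have := sum_level (fun k => 2 ^+ k : R) (dot (w *m (v^T *m v)) w : R^o) iL.
rewrite /GRing.scale /= => ->.
have -> : dot (w *m (v^T *m v)) w = dot v w ^+ 2.
  rewrite mulmxA dot_mulr dotE big_ord1 expr2.
  by congr (_ * _); rewrite dotC //.
by rewrite [2 ^+ i.+1]exprS; ring.
Qed.

(* Every move of a direction v one level up raises the weighted trace
   [\sum_k k * tr (A P_k A^T)] by exactly [|A v|^2]. *)
Lemma potential p (A : 'M_(p, N)) l : valid l ->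
  \sum_(e <- l) dot (e.2 *m A^T) (e.2 *m A^T) <= L%:R * \tr (A *m A^T).
Proof.
move=> lv.
have -> : \sum_(e <- l) dot (e.2 *m A^T) (e.2 *m A^T)
    = \sum_(k < L.+1) k%:R * \tr (A *m proj l k *m A^T).
  elim: l lv => [|[i v] l IH] /=.
    move=> _; rewrite big_nil big_ord_recl /= mul0r add0r big1 // => k _.
    by rewrite mulmx0 mul0mx mxtrace0 mulr0.
  case=> lv iL v1 vk; rewrite big_cons IH //=.
  under [RHS]eq_bigr do
    rewrite mulmxDr mulmxDl -scalemxAr -scalemxAl linearD linearZ /= mulrDr mulrA.
  rewrite big_split /= addrC; congr (_ + _).
  have := sum_level (fun k => k%:R) (\tr (A *m (v^T *m v) *m A^T) : R^o) iL.
  rewrite /GRing.scale /= => ->.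
  rewrite -natr1 [X in X * _](_ : _ = 1) ?mul1r; last by lra.
  rewrite mulmxA -mulmxA mxtrace_mulC /dot trmx_mul trmxK.
  by rewrite /mxtrace big_ord1.
have -> : A *m A^T = \sum_(k < L.+1) A *m proj l k *m A^T.
  by rewrite -mulmx_suml -mulmx_sumr sum_proj ?mulmx1.
rewrite raddf_sum mulr_sumr.
apply: ler_sum => k _; apply: ler_wpM2r; last by rewrite ler_nat -ltnS.
rewrite /= (_ : A *m proj l k *m A^T = (A *m proj l k) *m (A *m proj l k)^T).
  rewrite /mxtrace sumr_ge0 // => i _.
  by rewrite mxE sumr_ge0 // => j _; rewrite [X in _ * X]mxE -expr2 sqr_ge0.
by rewrite trmx_mul tr_proj mulmxA -(mulmxA A (proj l k) (proj l k)) proj_mul ?eqxx.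
Qed.

(** The potential bound for the identity matrix: each move contributes 1, and the trace is [N]. *)
Lemma size_valid l : valid l -> (size l <= N * L)%N.
Proof.
move=> lv; have := potential 1%:M lv.
rewrite trmx1 mulmx1 mxtrace1 -natrM mulnC -(ler_nat R) => /(le_trans _); apply.
rewrite -sum1_size natr_sum.
elim: l lv => [|[i v] l IH] /=; first by rewrite !big_nil.
case=> lv _ v1 _; rewrite !big_cons /= mulmx1 v1 lerD2l; exact: IH.
Qed.

End Projections.

(** * Freezing coordinates *)


Section Fenwick.
Local Open Scope nat_scope.

Lemma sum_doubled (F : nat -> nat) n :
  \sum_(0 <= b < n.*2) F b = \sum_(0 <= c < n) (F c.*2 + F c.*2.+1).
Proof.
elim: n => [|n IH]; first by rewrite !big_geq.
by rewrite doubleS !big_nat_recr //= IH addnA.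
Qed.

(* A point lies in at most [H] of the Fenwick intervals [(b - lowbit b, b]]
   with [b < 2 ^ H]; the point is the jump of [f]. *)
Lemma fenwick_stab (f : nat -> bool) H : {homo f : a b / a <= b >-> a ==> b} ->
  \sum_(0 <= b < 2 ^ H) (f b && ~~ f (b - 2 ^ logn 2 b)) <= H.
Proof.
elim: H f => [|H IH] f fmono.
  by rewrite big_nat1 sub0n andbN.
rewrite expnS mul2n sum_doubled big_split /=.
have gmono : {homo (fun c => f c.*2) : a b / a <= b >-> a ==> b}.
  by move=> a b ab; apply: fmono; rewrite leq_double.
(* Doubling an index doubles its lowest bit, so the even indices reduce to [H] and the predicate
   [f c.*2]. *)
have even_part : \sum_(0 <= c < 2 ^ H) (f c.*2 && ~~ f (c.*2 - 2 ^ logn 2 c.*2)) <= H.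
  apply: leq_trans (IH _ gmono); apply: leq_sum => -[|c] _.
    by rewrite double0 !sub0n andbN.
  rewrite -mul2n lognM // logn_prime //= add1n expnS -mulnBr mul2n mul2n.
  exact: leqnn.
(* Odd indices have intervals of length one, so at most one of them contains the jump. *)
have odd_part n : \sum_(0 <= c < n) (f c.*2.+1 && ~~ f (c.*2.+1 - 2 ^ logn 2 c.*2.+1))
    <= f n.*2.
  elim: n => [|n IHn]; first by rewrite big_geq.
  rewrite big_nat_recr //= lognE /= dvdn2 /= odd_double /= subn1 /=.
  have := fmono n.*2.+1 n.+1.*2; rewrite doubleS leqnSn => /(_ isT).
  have := fmono n.*2 n.*2.+2; rewrite -addn2 leq_addr => /(_ isT).
  rewrite addn2; move: IHn.
  by case: (f n.*2); case: (f n.*2.+1); case: (f n.*2.+2) => //=; lia.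
rewrite -[leqRHS]addn1; apply: leq_add => //; apply: leq_trans (odd_part _) _.
exact: leq_b1.
Qed.

End Fenwick.

(** * Rows emitted by one copy *)

Section Emission.
Variables (R : realType) (N L : nat) (K : R).
Hypothesis K1 : 1 <= K.
Implicit Types (l : seq (nat * 'rV[R]_N)) (v w : 'rV[R]_N) (B : {set 'I_N}).

Local Notation "'e_ j" := (delta_mx 0 j : 'rV[R]_N) (at level 8, j at level 2).

Definition frozen l : {set 'I_N} := [set j | K < qform (raw l) 'e_j].

Definition main_row (e : nat * 'rV[R]_N) l : 'rV[R]_N :=
  (Num.sqrt (2 ^+ e.1) *: e.2) *m res R (~: frozen (e :: l)).

Fixpoint main l : seq 'rV[R]_N :=
  if l is e :: l' then main_row e l' :: main l'
  else [seq 'e_j | j <- enum 'I_N].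

(** Coordinates frozen during the Fenwick interval that ends at the current step [size l]; dropping
    from the head goes back in time. *)
Definition block l : {set 'I_N} :=
  frozen l :\: frozen (drop (2 ^ logn 2 (size l)) l).

Definition aux l := [seq r *m res R (block l) | r <- main l].

Fixpoint auxs l := if l is e :: l' then auxs l' ++ aux l else [::].

(** Oldest row first, unlike [raw] and [main], because emitted rows may only be appended. *)
Fixpoint out l : seq 'rV[R]_N :=
  if l is e :: l' then out l' ++ main_row e l' :: aux l
  else [seq 'e_j | j <- enum 'I_N].

Lemma out_suffix s l : exists t, out (s ++ l) = out l ++ t.
Proof.
elim: s => [|e s [t IH]]; first by exists [::]; rewrite cats0.
by exists (t ++ main_row e (s ++ l) :: aux (e :: s ++ l)); rewrite /= IH catA.
Qed.

Lemma qform_raw_suffix s l w : qform (raw l) w <= qform (raw (s ++ l)) w.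
Proof.
elim: s => //= -[i v] s IH; rewrite qform_cons (le_trans IH) // lerDr.
exact: sqr_ge0.
Qed.

Lemma frozen_suffix s l : frozen l \subset frozen (s ++ l).
Proof.
apply/subsetP => j; rewrite !inE => /lt_le_trans; apply.
exact: qform_raw_suffix.
Qed.

Lemma frozen_drop k l : frozen (drop k l) \subset frozen l.
Proof. by rewrite -{2}(cat_take_drop k l) frozen_suffix. Qed.

Lemma frozen_cons e l : frozen l \subset frozen (e :: l).
Proof. exact: (frozen_suffix [:: e]). Qed.

Lemma frozen_nil : frozen [::] = set0.
Proof.
apply/setP => j; rewrite !inE /= qform_basis dot_delta mxE !eqxx.
by apply/negbTE; rewrite -leNgt.
Qed.

Lemma delta_res_sqr_le r B j : dot r ('e_j *m res R B) ^+ 2 <= dot r 'e_j ^+ 2.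
Proof.
rewrite delta_res; case: ifP => // _.
by rewrite dotC dot0l expr0n sqr_ge0.
Qed.

Lemma main_le_raw l j : qform (main l) 'e_j <= qform (raw l) 'e_j.
Proof.
elim: l => //= -[i v] l IH; rewrite !qform_cons lerD //.
by rewrite /main_row dot_mulr tr_res delta_res_sqr_le.
Qed.

Lemma main_le l j : qform (main l) 'e_j <= K.
Proof.
elim: l => [|[i v] l IH]; first by rewrite /= qform_basis dot_delta mxE !eqxx.
have [jF|jF] := boolP (j \in frozen ((i, v) :: l)); last first.
  by apply: le_trans (main_le_raw _ _) _; rewrite inE -leNgt in jF.
rewrite /= qform_cons /main_row dot_mulr tr_res delta_res inE jF /=.
by rewrite dotC dot0l expr0n add0r.
Qed.

(** Frozen sets only grow, so no mask applied so far acts outside [S]. *)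
Lemma main_raw l (S : {set 'I_N}) w : frozen l \subset S ->
  qform (raw l) (w *m res R (~: S)) = qform (main l) (w *m res R (~: S)).
Proof.
elim: l => //= -[i v] l IH sS; rewrite !qform_cons IH; last first.
  exact: subset_trans (frozen_cons _ _) sS.
congr (_ ^+ 2 + _); rewrite /main_row [RHS]dot_mulr tr_res -mulmxA mul_res_sub //.
by rewrite setCS.
Qed.

Lemma main_stable s l w :
  qform (main (s ++ l)) (w *m res R (frozen l)) = qform (main l) (w *m res R (frozen l)).
Proof.
elim: s => //= e s IH; rewrite qform_cons IH.
rewrite /main_row dot_mulr tr_res -mulmxA res_mul.
have /setIidPl sub : frozen l \subset frozen (e :: s ++ l).
  exact: (frozen_suffix (e :: s) l).
rewrite -sub -setIA setICr setI0 res_set0 mulmx0 dotC dot0l.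
by rewrite expr0n add0r.
Qed.

Lemma auxs_drop k l w : qform (auxs (drop k l)) w <= qform (auxs l) w.
Proof.
elim: l k => [|e l IH] [|k] //; apply: le_trans (IH k) _.
by rewrite [auxs (e :: l)]/= qform_cat lerDl qform_ge0.
Qed.

Lemma qform_out l w : qform (out l) w = qform (main l) w + qform (auxs l) w.
Proof.
elim: l => [|e l IH]; first by rewrite /= qform_nil addr0.
rewrite [out _]/= [auxs _]/= [main (e :: l)]/= !qform_cat !qform_cons IH; ring.
Qed.

Lemma fenwick_chain h a l w : (2 ^ a %| size l)%N -> (size l < 2 ^ (h + a))%N ->
  qform (main l) (w *m res R (frozen l)) <= h%:R * qform (auxs l) w.
Proof.
have [n] := ubnP (size l).
elim: n h a l => // n IH h a [|x l'].
  move=> _ _ _; rewrite frozen_nil res_set0 mulmx0 /= qform_nil mulr0.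
  by rewrite /qform big1 // => r _; rewrite dotC dot0l expr0n.
set l := x :: l'; set m := size l; set e := logn 2 m => ln am mh.
have m0 : (0 < m)%N by [].
have ae : (a <= e)%N by rewrite -pfactor_dvdn.
have em : (2 ^ e <= m)%N by apply: dvdn_leq (pfactor_dvdnn 2 m).
have e0 : (0 < 2 ^ e)%N by rewrite expn_gt0.
case: h mh => [|h] mh.
  by move: (dvdn_leq m0 am); rewrite leqNgt mh.
have sl1 : size (drop (2 ^ e) l) = (m - 2 ^ e)%N by rewrite size_drop.
have bound : qform (main (drop (2 ^ e) l)) (w *m res R (frozen (drop (2 ^ e) l)))
    <= h%:R * qform (auxs (drop (2 ^ e) l)) w.
  apply: (IH h e.+1); rewrite sl1.
  - by move: ln; rewrite ltnS; apply: leq_trans; rewrite ltn_subrL e0 m0.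
  - have [q qodd ->] := pfactor_coprime (isT : prime 2) m0.
    rewrite -/e -{2}(mul1n (2 ^ e)%N) -mulnBl expnS dvdn_pmul2r // dvdn2.
    by case: q qodd => [|q]; rewrite ?coprime2n //= subn1 /= => ->.
  - apply: leq_ltn_trans (leq_subr _ _) _; apply: leq_trans mh _.
    by rewrite leq_exp2l // addSnnS leq_add2l ltnS.
have -> : w *m res R (frozen l)
    = w *m res R (block l) + w *m res R (frozen (drop (2 ^ e) l)).
  by rewrite /block res_setD ?frozen_drop // mulmxBr subrK.
(* Main rows created since the earlier step are masked on what was frozen by then. *)
have stab : qform (main l) (w *m res R (frozen (drop (2 ^ e) l)))
    = qform (main (drop (2 ^ e) l)) (w *m res R (frozen (drop (2 ^ e) l))).
  by rewrite -{1}(cat_take_drop (2 ^ e) l) main_stable.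
rewrite -stab in bound.
apply: le_trans (qform_add _ (qform_ge0 _ _) bound) _.
rewrite ler_wpM2l ?ler0n // addrC [leRHS]qform_cat lerD ?qform_res //.
case: (2 ^ e)%N e0 => // k _; exact: (auxs_drop k l').
Qed.

(** On unfrozen coordinates [raw] and [main] agree; the masked [w] is [w] minus its frozen part, and
    the chain of blocks recovers that part. *)
Lemma out_cover H l w : (size l < 2 ^ H)%N ->
  qform (raw l) (w *m res R (~: frozen l)) <= H.+1%:R * qform (out l) w.
Proof.
move=> lH; rewrite main_raw // res_setC mulmxBr mulmx1 qform_out.
apply: qform_add; first exact: qform_ge0.
by rewrite qformN; apply: (@fenwick_chain _ 0); rewrite ?addn0 ?dvd1n.
Qed.

(** A coordinate freezes at most once, hence lies in at most [H] blocks, and each block repeats main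
    rows of diagonal at most [K]. *)
Lemma auxs_le H l j : (size l < 2 ^ H)%N -> qform (auxs l) 'e_j <= K * H%:R.
Proof.
move=> lH.
(* [f l b] says that [j] is frozen after the first [b] moves. *)
pose f l b := j \in frozen (drop (size l - b) l).
pose t l b := f l b && ~~ f l (b - 2 ^ logn 2 b)%N.
have : qform (auxs l) 'e_j <= K * (\sum_(0 <= b < (size l).+1) t l b)%N%:R.
  elim: l {lH} => [|x l IH].
    by rewrite /= qform_nil mulr_ge0 // (le_trans ler01).
  rewrite [auxs _]/= qform_cat [size _]/= big_nat_recr //= natrD mulrDr lerD //.
    rewrite [X in _ * X%:R](_ : _ = (\sum_(0 <= b < (size l).+1) t l b)%N) //.
    rewrite big_nat [RHS]big_nat; apply: eq_bigr => b /= /[!ltnS] bl.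
    have feq c : (c <= b)%N -> f (x :: l) c = f l c.
      by move=> cb; rewrite /f /= subSn // (leq_trans cb).
    by rewrite /t !feq // leq_subr.
  rewrite /aux qform_res delta_res.
  have -> : (j \in block (x :: l)) = t (x :: l) (size l).+1.
    rewrite /block /t /f inE andbC /= subnn drop0.
    rewrite subKn //; apply: dvdn_leq (pfactor_dvdnn 2 _) => //.
  case: (t _ _); rewrite ?mulr1 ?main_le // mulr0.
  by rewrite /qform big1 // => r _; rewrite dotC dot0l expr0n.
move=> /le_trans; apply; rewrite ler_wpM2l ?(le_trans ler01) // ler_nat.
have fmono : {homo f l : a b / (a <= b)%N >-> a ==> b}.
  move=> a b ab; apply/implyP; apply/subsetP.
  rewrite -[(size l - a)%N](subnK (leq_sub2l _ ab)) -drop_drop.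
  exact: frozen_drop.
apply: leq_trans (fenwick_stab H fmono).
by rewrite (@big_cat_nat _ _ _ (size l).+1 0 (2 ^ H)) //= leq_addr.
Qed.

Lemma out_le H l j : (size l < 2 ^ H)%N -> qform (out l) 'e_j <= K * H.+1%:R.
Proof.
move=> lH; rewrite qform_out -natr1 mulrDr mulr1 addrC lerD ?main_le //.
exact: auxs_le.
Qed.

End Emission.

(** * Updating one copy *)


Section Update.
Variables (R : realType) (N L : nat).
Implicit Types (l : seq (nat * 'rV[R]_N)) (v w x q : 'rV[R]_N) (B : {set 'I_N}).

Local Notation "'e_ j" := (delta_mx 0 j : 'rV[R]_N) (at level 8, j at level 2).

Definition violated l x : option 'I_L :=
  [pick k : 'I_L | 2 ^+ k < dot (x *m proj l k) (x *m proj l k)].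

Definition normalize v : 'rV[R]_N := (Num.sqrt (dot v v))^-1 *: v.

Definition push x l :=
  if violated l x is Some k then (k : nat, normalize (x *m proj l k)) :: l else l.

Definition advance x l := iter (N * L).+1 (push x) l.

Lemma dot_normalize v : 0 < dot v v -> dot (normalize v) (normalize v) = 1.
Proof.
move=> v0; rewrite dotZl dotZr mulrA -expr2 exprVn sqr_sqrtr ?ltW //.
by rewrite mulVf // gt_eqF.
Qed.

Lemma advance_suffix x l : exists s, advance x l = s ++ l.
Proof.
rewrite /advance; elim: (N * L).+1 => [|n [s /= ->]]; first by exists [::].
rewrite /push; case: violated => [k|]; last by exists s.
by exists ((k : nat, normalize (x *m proj (s ++ l) k)) :: s).
Qed.

(** Each iteration either finds no violated level or adds a move; [N * L + 1] additions would
    contradict [size_valid]. *)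
Lemma advance_done x l : valid L (advance x l) -> violated (advance x l) x = None.
Proof.
have : forall n, violated (iter n (push x) l) x = None
    \/ size (iter n (push x) l) = (size l + n)%N.
  elim=> [|n [IH|IH]] /=; first by right; rewrite addn0.
    by left; rewrite /push IH.
  rewrite {2 3}/push; case E : (violated (iter n (push x) l) x) => [k|].
    by right; rewrite /= IH addnS.
  by left; rewrite /push E.
move=> /(_ (N * L).+1) [-> //|sz] /size_valid.
by rewrite /advance sz; lia.
Qed.

Definition supported B l := forall e, e \in l -> e.2 *m res R B = e.2.

(** Charges the trace increment [2 ^ i] of a move to its potential gain [|M v|^2]. *)
Definition heavy p (M : 'M[R]_(p, N)) l :=
  forall e, e \in l -> 2 ^+ e.1 <= 4 * dot (e.2 *m M^T) (e.2 *m M^T).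

Definition class_inv p (M : 'M[R]_(p, N)) B l :=
  [/\ valid L l, supported B l & heavy M l].

Lemma mul_res_subset (A B : {set 'I_N}) v : A \subset B ->
  v *m res R A = v -> v *m res R B = v.
Proof. by move=> AB vA; rewrite -vA -mulmxA mul_res_sub. Qed.

Lemma class_inv_subset p (M : 'M_(p, N)) (A B : {set 'I_N}) l : A \subset B ->
  class_inv M A l -> class_inv M B l.
Proof.
move=> AB [lv ls lh]; split=> // e el.
exact: mul_res_subset AB (ls e el).
Qed.

(** Moves supported in [B] leave the initial levels, 1 and then zeros, untouched outside [B]. *)
Lemma proj_resC B l k : supported B l ->
  proj l k *m res R (~: B) = (k == 0%N)%:R *: res R (~: B).
Proof.
elim: l => [|[i v] l IH] /= ls.
  by case: eqP => _; rewrite ?mul1mx ?scale1r // mul0mx scale0r.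
rewrite mulmxDl IH; last by move=> e el; apply: ls; rewrite inE el orbT.
have := ls (i, v); rewrite inE eqxx => /(_ isT) /= vB.
rewrite -scalemxAl -mulmxA -{2}vB -mulmxA res_mul setICr res_set0 !mulmx0.
by rewrite scaler0 addr0.
Qed.

Lemma proj_supported B l k x : supported B l -> x *m res R B = x ->
  x *m proj l k *m res R B = x *m proj l k.
Proof.
move=> ls xB; have : x *m proj l k *m res R (~: B) = 0.
  rewrite -mulmxA proj_resC // -scalemxAr -xB -mulmxA res_mul setICr.
  by rewrite res_set0 mulmx0 scaler0.
by rewrite res_setC mulmxBr mulmx1 => /eqP; rewrite subr_eq0 => /eqP.
Qed.

Definition dominates p (M : 'M[R]_(p, N)) q :=
  forall w, dot q w ^+ 2 <= 4 * dot (w *m M^T) (w *m M^T).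

Lemma push_inv p (M : 'M_(p, N)) B q l : dominates M q ->
  class_inv M B l -> class_inv M B (push (q *m res R B) l).
Proof.
move=> qM [lv ls lh]; rewrite /push /violated; case: pickP => //= k.
set x := q *m res R B; set u := x *m proj l k => ku.
have u0 : 0 < dot u u by apply: lt_trans ku; rewrite exprn_gt0.
have xB : x *m res R B = x by rewrite /x -mulmxA res_mul setIid.
have uB : normalize u *m res R B = normalize u.
  by rewrite -scalemxAl proj_supported.
split=> [|e|e].
- split=> //; first by rewrite dot_normalize.
  by rewrite -scalemxAl -mulmxA (proj_mul _ _ lv) eqxx.
- by rewrite inE => /predU1P[-> //|]; apply: ls.
rewrite inE => /predU1P[->|]; last exact: lh.
(* For [v = u / |u|], supported in [B], one has [<q, v> = <x, v> = |u|], so the violation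
   [2^k < |u|^2] bounds [2^k] by [<q, v>^2]. *)
apply: le_trans (qM (normalize u)); apply: le_trans (ltW ku) _ => /=.
rewrite -uB -[res R B]tr_res -dot_mulr -/x dotZr exprMn exprVn (sqr_sqrtr (ltW u0)).
have -> : dot x u = dot u u by rewrite /u dotC (dot_proj _ _ _ lv).
by rewrite expr2 mulKf ?lexx // gt_eqF.
Qed.

Lemma advance_inv p (M : 'M_(p, N)) B q l : dominates M q ->
  class_inv M B l -> class_inv M B (advance (q *m res R B) l).
Proof.
move=> qM lB; rewrite /advance; elim: (N * L).+1 => [|n IH] //=.
exact: push_inv.
Qed.

Definition col_bounded p (M : 'M[R]_(p, N)) := forall j, \sum_i M i j ^+ 2 <= 1.

Lemma sum_raw p (M : 'M_(p, N)) B l : col_bounded M -> class_inv M B l ->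
  \sum_(j in B) qform (raw l) 'e_j <= (#|B| * (1 + 4 * L))%N%:R.
Proof.
move=> M1 [lv ls lh].
have sum_pow : \sum_(j in B) qform (raw l) 'e_j <= #|B|%:R + \sum_(e <- l) 2 ^+ e.1.
  elim: l lv {ls lh} => [|[i v] l IH] /=.
    rewrite big_nil addr0 -sum1_card natr_sum => _; apply: ler_sum => j _.
    by rewrite qform_basis dot_delta mxE !eqxx.
  case=> lv _ v1 _; under eq_bigr do rewrite qform_cons.
  rewrite big_split /= big_cons /= addrCA lerD ?IH //.
  under eq_bigr do rewrite dotZl exprMn sqr_sqrtr ?exprn_ge0 // dot_delta.
  rewrite -mulr_sumr -[leRHS]mulr1 ler_wpM2l ?exprn_ge0 // -v1 dotE.
  rewrite [leRHS](bigID (mem B)) /= -[leLHS]addr0 lerD //.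
  by rewrite sumr_ge0 // => j _; rewrite -expr2 sqr_ge0.
apply: le_trans sum_pow _; rewrite mulnDr muln1 natrD lerD2l.
(* The moves live in [B], so masking [M] keeps its values on them while bounding the trace by [#|B|]
   instead of [N]. *)
pose A := M *m res R B.
have sum_A : \sum_(e <- l) 2 ^+ e.1 <= 4 * \sum_(e <- l) dot (e.2 *m A^T) (e.2 *m A^T).
  rewrite mulr_sumr !big_seq; apply: ler_sum => e el.
  rewrite /A trmx_mul tr_res mulmxA ls //; exact: lh.
apply: le_trans sum_A _; apply: le_trans (ler_wpM2l _ (potential A lv)) _ => //.
have trA : \tr (A *m A^T) <= #|B|%:R.
  rewrite /mxtrace; under eq_bigr do rewrite mxE.
  rewrite exchange_big /= (bigID (mem B)) /= [X in _ + X]big1 ?addr0.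
    rewrite -sum1_card natr_sum; apply: ler_sum => j jB.
    apply: le_trans (M1 j); apply: ler_sum => i _.
    by rewrite [X in _ * X]mxE /A mul_mx_diag !mxE jB mulr1 expr2.
  move=> j jB; apply: big1 => i _.
  by rewrite /A mul_mx_diag !mxE (negPf jB) mulr0 mul0r.
by rewrite (natrM _ #|B|) (natrM _ 4) [leRHS]mulrC -mulrA !ler_wpM2l ?ler0n //.
Qed.

Local Notation K := ((2 * (1 + 4 * L))%N%:R : R).

Lemma frozen_sub p (M : 'M_(p, N)) B l : class_inv M B l -> frozen K l \subset B.
Proof.
case=> _ ls _; apply/subsetP => j; rewrite inE; apply: contraLR => jB.
rewrite -leNgt; have -> : qform (raw l) 'e_j = 1.
  elim: l ls => [|[i v] l IH] ls /=.
    by rewrite qform_basis dot_delta mxE !eqxx.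
  rewrite qform_cons IH; last by move=> e el; apply: ls; rewrite inE el orbT.
  have := ls (i, v); rewrite inE eqxx => /(_ isT) /= <-.
  by rewrite dotZl dot_delta mul_resE (negPf jB) mulr0 expr0n add0r.
by rewrite ler1n muln_gt0.
Qed.

(** Markov's inequality: [K] is twice the bound that [sum_raw] gives for the average diagonal entry
    on [B]. *)
Lemma frozen_card p (M : 'M_(p, N)) B l : col_bounded M -> class_inv M B l ->
  (2 * #|frozen K l| <= #|B|)%N.
Proof.
move=> M1 lB; have := sum_raw M1 lB.
have FB := frozen_sub lB.
have KF : (#|frozen K l| * (2 * (1 + 4 * L)))%N%:R <= \sum_(j in frozen K l) qform (raw l) 'e_j.
  rewrite -sum1_card big_distrl natr_sum; apply: ler_sum => j.
  by rewrite inE /= mul1n => /ltW.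
have : \sum_(j in frozen K l) qform (raw l) 'e_j <= \sum_(j in B) qform (raw l) 'e_j.
  rewrite [leRHS](bigID (mem (frozen K l))) /=.
  rewrite -[leLHS]addr0 lerD //; last by rewrite sumr_ge0 // => j _; apply: qform_ge0.
  rewrite le_eqVlt; apply/orP; left; apply/eqP; apply: eq_bigl => j.
  by case jF : (j \in frozen K l); rewrite ?andbF // (subsetP FB).
by move=> /(le_trans KF) /le_trans h /h; rewrite ler_nat mulnA leq_pmul2r // mulnC.
Qed.

(** Split [x] over the [L + 1] levels and apply Cauchy-Schwarz across and within them. Below [L],
    [|P_k x|^2 <= 2^k] as nothing is violated; the top level is never tested and relies on
    [|x|^2 <= 2^L]. *)
Lemma class_cover l x w : valid L l -> violated l x = None -> dot x x <= 2 ^+ L ->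
  dot x w ^+ 2 <= L.+1%:R * qform (raw l) w.
Proof.
rewrite /violated => lv; case: pickP => // noviol _ xL.
have -> : dot x w = \sum_(k < L.+1) dot (x *m proj l k) (w *m proj l k).
  rewrite -{1}[x]mulmx1 -(sum_proj lv) mulmx_sumr dot_suml.
  by apply: eq_bigr => k _; rewrite -(dot_proj _ _ _ lv).
apply: le_trans (sqr_sum_le _ _) _.
rewrite [size _](_ : _ = L.+1); last by rewrite /index_enum -enumT size_enum_ord.
rewrite ler_wpM2l ?ler0n // (qform_raw _ lv); apply: ler_sum => k _.
apply: le_trans (dot_CS _ _) _; rewrite ler_wpM2r ?dot_ge0 //.
have [kL | ] := ltnP k L.
  by rewrite leNgt; apply: contraFN (noviol (Ordinal kL)).
move=> Lk; have {Lk}-> : k = L :> nat by apply/eqP; rewrite eqn_leq Lk -ltnS ltn_ord.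
apply: le_trans xL; rewrite -(dot_proj _ _ _ lv) dotC.
(* Bessel's inequality: [|x - P_L x|^2 = |x|^2 - |P_L x|^2]. *)
have := dot_ge0 (x - x *m proj l L).
rewrite dotBl !(dotC _ (x - _)) !dotBl -(dotC x) -(dot_proj _ _ _ lv).
by rewrite (dotC _ x); lra.
Qed.

End Update.

(** * The cascade of copies *)


Section Cascade.
Variables (R : realType) (N L T H : nat).
Hypotheses (NL : (4 * N <= 2 ^ L)%N) (NT : (N < 2 ^ T)%N) (NH : (N * L < 2 ^ H)%N).
Implicit Types (st : nat -> seq (nat * 'rV[R]_N)) (q w : 'rV[R]_N) (qs : seq 'rV[R]_N).

Local Notation "'e_ j" := (delta_mx 0 j : 'rV[R]_N) (at level 8, j at level 2).
Local Notation K := ((2 * (1 + 4 * L))%N%:R : R).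

Let K1 : 1 <= K. Proof. by rewrite ler1n muln_gt0. Qed.

Definition scope st (i : nat) : {set 'I_N} :=
  if i is i'.+1 then frozen K (st i') else setT.

(** Copy [i + 1] sees [q] on the coordinates frozen by copy [i] after that copy has processed
    [q]. *)
Fixpoint update q st (i : nat) : seq (nat * 'rV[R]_N) :=
  if i is i'.+1 then advance L (q *m res R (frozen K (update q st i'))) (st i)
  else advance L (q *m res R setT) (st 0%N).

Lemma updateE q st i :
  update q st i = advance L (q *m res R (scope (update q st) i)) (st i).
Proof. by case: i. Qed.

Definition run qs := foldl (fun st q => update q st) (fun=> [::]) qs.

Lemma run_rcons qs q : run (rcons qs q) = update q (run qs).
Proof. by rewrite /run foldl_rcons. Qed.

Lemma update_suffix q st i : exists s, update q st i = s ++ st i.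
Proof. by rewrite updateE; apply: advance_suffix. Qed.

(** Scopes only grow, so earlier moves remain supported in them. *)
Lemma scope_update q st i : scope st i \subset scope (update q st) i.
Proof.
case: i => //= i; have [s ->] := update_suffix q st i.
exact: frozen_suffix.
Qed.

Lemma run_inv p (M : 'M_(p, N)) qs i : (forall q, q \in qs -> dominates M q) ->
  class_inv L M (scope (run qs) i) (run qs i).
Proof.
elim/last_ind: qs => [|qs q IH] qM; first by split.
rewrite run_rcons updateE; apply: advance_inv.
  by apply: qM; rewrite mem_rcons mem_head.
apply: class_inv_subset (scope_update q _ i) (IH _) => r rq.
by apply: qM; rewrite mem_rcons inE rq orbT.
Qed.

Lemma scope_card p (M : 'M_(p, N)) qs i : col_bounded M ->
  (forall q, q \in qs -> dominates M q) -> (2 ^ i * #|scope (run qs) i| <= N)%N.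
Proof.
move=> M1 qM; elim: i => [|i IH]; first by rewrite mul1n cardsT card_ord.
apply: leq_trans IH; rewrite expnSr -mulnA leq_mul2l; apply/orP; right.
exact: frozen_card M1 (run_inv i qM).
Qed.

(** With [x i] the restriction of [q] to scope [i], [q] is the telescoping sum of the unfrozen parts
    [x i - x (i + 1)], since scope [T] is empty. The factors come from Cauchy-Schwarz over copies,
    [class_cover] and [out_cover]. *)
Lemma run_cover p (M : 'M_(p, N)) qs q w : col_bounded M ->
  (forall r, r \in rcons qs q -> dominates M r) ->
  dot q w ^+ 2 <=
  (T * L.+1 * H.+1)%N%:R * \sum_(0 <= i < T) qform (out K (run (rcons qs q) i)) w.
Proof.
move=> M1 qM; set st := run (rcons qs q).
have inv i : class_inv L M (scope st i) (st i) by apply: run_inv.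
have qq : dominates M q by apply: qM; rewrite mem_rcons mem_head.
have scopeT : scope st T = set0.
  apply/eqP; rewrite -cards_eq0; have := scope_card T M1 qM.
  rewrite -/st; case: #|_| => // n; rewrite leqNgt.
  by rewrite (leq_trans NT) // leq_pmulr.
pose x i := q *m res R (scope st i).
(* Domination at basis vectors gives [q_j^2 <= 4]. *)
have xL i : dot (x i) (x i) <= 2 ^+ L.
  apply: (@le_trans _ _ (4 * N)%N%:R); last by rewrite -natrX ler_nat.
  have NE : N%:R = \sum_(j < N) 1 :> R by rewrite sumr_const card_ord.
  rewrite natrM NE mulr_sumr dotE.
  apply: ler_sum => j _; rewrite /x mul_resE mulr1; case: ifP => _.
    rewrite -expr2 -dot_delta; apply: le_trans (qq _) _.
    rewrite -[leRHS]mulr1 ler_wpM2l //; apply: le_trans (M1 j).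
    by rewrite dotE; apply: ler_sum => k _; rewrite -rowE !mxE expr2.
  by rewrite mul0r.
have -> : dot q w = \sum_(0 <= i < T) dot (x i *m res R (~: frozen K (st i))) w.
  have tele i : x i *m res R (~: frozen K (st i)) = x i - x i.+1.
    rewrite res_setC mulmxBr mulmx1 /x -mulmxA res_mul setIC.
    by have /setIidPl -> := frozen_sub (inv i).
  under eq_bigr do rewrite tele dotBl -opprB.
  rewrite sumrN (telescope_sumr (fun i => dot (x i) w)) // opprB /x scopeT res_set0 mulmx0 dot0l subr0 /=.
  by rewrite res_setT mulmx1.
apply: le_trans (sqr_sum_le _ _) _; rewrite size_iota subn0 -mulnA (natrM _ T) -mulrA.
rewrite ler_wpM2l ?ler0n // mulr_sumr; apply: ler_sum => i _.
have [lv ls lh] := inv i.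
have done_i : violated L (st i) (x i) = None.
  rewrite /x /st run_rcons updateE; apply: advance_done.
  by rewrite -updateE -run_rcons.
rewrite dot_mulr tr_res; apply: le_trans (class_cover _ lv done_i (xL i)) _.
rewrite (natrM _ L.+1) -mulrA ler_wpM2l ?ler0n //; apply: out_cover => //.
exact: leq_ltn_trans (size_valid lv) NH.
Qed.

Definition emitted st st' :=
  flatten [seq drop (size (out K (st i))) (out K (st' i)) | i <- iota 0 T].

(** The new rows of all copies are appended at every step; joining the [out] lists copy by copy
    would not be append-only. *)
Definition core_step (p : (nat -> seq (nat * 'rV[R]_N)) * seq 'rV[R]_N) q :=
  (update q p.1, p.2 ++ emitted p.1 (update q p.1)).

Definition core qs := foldl core_step
  (fun=> [::], flatten [seq out K (Nil (nat * 'rV[R]_N)) | i <- iota 0 T]) qs.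

Lemma core_rcons qs q : core (rcons qs q) = core_step (core qs) q.
Proof. by rewrite /core foldl_rcons. Qed.

Lemma core_run qs : (core qs).1 = run qs.
Proof.
elim/last_ind: qs => // qs q IH.
by rewrite core_rcons run_rcons /= IH.
Qed.

Lemma qform_core qs w :
  qform (core qs).2 w = \sum_(0 <= i < T) qform (out K (run qs i)) w.
Proof.
elim/last_ind: qs => [|qs q IH]; first by rewrite qform_flatten /index_iota subn0.
rewrite core_rcons /= qform_cat IH core_run qform_flatten run_rcons.
rewrite /index_iota subn0 -big_split /=; apply: eq_bigr => i _.
have [s ->] := update_suffix q (run qs) i.
have [t ->] := out_suffix K s (run qs i).
by rewrite drop_size_cat // qform_cat.
Qed.

Lemma core_le p (M : 'M_(p, N)) qs j :
  (forall r, r \in qs -> dominates M r) ->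
  qform (core qs).2 'e_j <= (T * ((2 * (1 + 4 * L)) * H.+1))%N%:R.
Proof.
move=> qM; rewrite qform_core.
rewrite -{2}[T]subn0 -[(T - 0)%N](size_iota 0) -sum1_size big_distrl natr_sum.
apply: ler_sum => i _; rewrite /= mul1n (natrM _ _ H.+1); apply: out_le => //.
by have [lv _ _] := run_inv i qM; apply: leq_ltn_trans (size_valid lv) NH.
Qed.

End Cascade.

(** * The core algorithm with explicit constants *)

Section Core.
Variable R : realType.

Definition dominated N (qs : seq 'rV[R]_N) := exists p (M : 'M[R]_(p, N)),
  col_bounded M /\ forall q, q \in qs -> dominates M q.

Lemma core_algorithm N : let t := (trunc_log 2 N).+1%:R in
  exists f : seq 'rV[R]_N -> seq 'rV[R]_N,
  [/\ forall qs q, exists s, f (rcons qs q) = f qs ++ s,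
      forall qs j, dominated qs -> qform (f qs) (delta_mx 0 j) <= 104 * t ^+ 3
    & forall qs q w, dominated (rcons qs q) ->
      dot q w ^+ 2 <= 16 * t ^+ 3 * qform (f (rcons qs q)) w].
Proof.
move=> t; pose n := trunc_log 2 N.
have Nn : (N < 2 ^ n.+1)%N by apply: trunc_log_ltn.
(* In terms of [t = n + 1 >= 1]: [L = t + 2] and [H = 2 t + 1], so [2 (1 + 4 L) <= 26 t] and
   [L + 1, H + 1 <= 4 t]. This yields 104 and 16. *)
pose L := n.+3; pose T := n.+1; pose H := (n.+1 + n.+2)%N.
have NL : (4 * N <= 2 ^ L)%N.
  by rewrite /L (expnD 2 2 n.+1) leq_mul2l /= ltnW.
have NH : (N * L < 2 ^ H)%N.
  rewrite /H expnD; apply: leq_ltn_trans (_ : 2 ^ n.+1 * L < _)%N.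
    by rewrite leq_mul2r ltnW ?orbT.
  by rewrite ltn_pmul2l ?expn_gt0 // /L; elim: (n) => // m IH; rewrite expnS; lia.
have t1 : 1 <= t by rewrite ler1n.
exists (fun qs => (core L T qs).2); split=> [qs q|qs j [p [M [M1 qM]]]|qs q w [p [M [M1 qM]]]].
- by rewrite core_rcons; eexists.
- apply: le_trans (core_le T NH j qM) _.
  have -> : 104 * t ^+ 3 = (104 * n.+1 ^ 3)%N%:R by rewrite natrM natrX.
  by rewrite ler_nat /T /L /H; nia.
rewrite qform_core; apply: le_trans (run_cover NL Nn NH w M1 qM) _.
rewrite ler_wpM2r ?sumr_ge0 // => [i _|]; first exact: qform_ge0.
have -> : 16 * t ^+ 3 = (16 * n.+1 ^ 3)%N%:R by rewrite natrM natrX.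
by rewrite ler_nat /L /H; nia.
Qed.

End Core.

(** * The factorization norm *)


Section Gamma2.
Variable R : realType.

Lemma mul_col_dot m n (q : 'rV[R]_m) (A : 'M_(m, n)) i :
  (q *m A) 0 i = dot q (col i A)^T.
Proof. by rewrite mxE dotE; apply: eq_bigr => j _; rewrite !mxE. Qed.

Lemma mul_col m n p (A : 'M[R]_(m, n)) (B : 'M_(n, p)) i :
  col i (A *m B) = A *m col i B.
Proof. by rewrite !colE mulmxA. Qed.

(** The converse half of the duality. The kernel of [G = M^T M] annihilates [q], so [q = z G]; for
    [l = z M^T] the hypothesis at [w = z] reads [|l|^4 <= c |l|^2]. *)
Lemma coeff_exists n N (M : 'M[R]_(n, N)) q c : 0 <= c ->
  (forall w, dot q w ^+ 2 <= c * dot (w *m M^T) (w *m M^T)) ->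
  exists l : 'rV_n, l *m M = q /\ dot l l <= c.
Proof.
move=> c0 qM; pose G := M^T *m M.
have /submxP[z qE] : (q <= G)%MS.
  rewrite submxE; apply/eqP/rowP => i; rewrite [RHS]mxE.
  pose w := (col i (cokermx G))^T.
  have -> : (q *m cokermx G) 0 i = dot q w.
    exact: mul_col_dot.
  have Gw : G *m w^T = 0 by rewrite trmxK -mul_col mulmx_coker colE mul0mx.
  have w0 : dot (w *m M^T) (w *m M^T) = 0.
    by rewrite /dot trmx_mul trmxK -mulmxA (mulmxA M^T) Gw mulmx0 mxE.
  by have := qM w; rewrite w0 mulr0 => /(conj (sqr_ge0 _))/andP/le_anti/esym/eqP; rewrite sqrf_eq0 => /eqP.
exists (z *m M^T); split; first by rewrite -mulmxA -/G.
have zz : dot q z = dot (z *m M^T) (z *m M^T).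
  by rewrite qE /dot trmx_mul trmxK !mulmxA.
have := qM z; rewrite zz; have := dot_ge0 (z *m M^T).
rewrite le_eqVlt => /predU1P[<- // | d0].
by rewrite expr2 ler_pM2r.
Qed.

Lemma rnorm2_ge0 n (v : 'rV[R]_n) : 0 <= rnorm2 v.
Proof. exact: sqrtr_ge0. Qed.

Lemma rnorm2_sqr n (v : 'rV[R]_n) : rnorm2 v ^+ 2 = dot v v.
Proof.
rewrite sqr_sqrtr; first by rewrite dotE; apply: eq_bigr => j _; rewrite expr2.
by rewrite sumr_ge0 // => j _; rewrite sqr_ge0.
Qed.

Lemma cnorm2_tr n (v : 'cV[R]_n) : cnorm2 v = rnorm2 v^T.
Proof. by congr Num.sqrt; apply: eq_bigr => i _; rewrite mxE. Qed.

Lemma norm_2inf_ge0 m n (A : 'M[R]_(m, n)) : 0 <= norm_2inf A.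
Proof.
rewrite /norm_2inf; elim/big_ind: _ => // [x y x0 y0|i _]; last exact: rnorm2_ge0.
by rewrite le_max x0.
Qed.

Lemma norm_2inf_tr m n (A : 'M[R]_(m, n)) : norm_2inf A^T = norm_12 A.
Proof.
rewrite /norm_2inf /norm_12; apply: eq_bigr => i _.
by rewrite cnorm2_tr tr_col.
Qed.

Lemma norm_12_ge0 m n (A : 'M[R]_(m, n)) : 0 <= norm_12 A.
Proof. by rewrite -norm_2inf_tr norm_2inf_ge0. Qed.

Lemma row_le_norm m n (A : 'M[R]_(m, n)) i : dot (row i A) (row i A) <= norm_2inf A ^+ 2.
Proof.
rewrite -rnorm2_sqr lerXn2r ?nnegrE ?rnorm2_ge0 ?norm_2inf_ge0 //.
exact: (le_bigmax _ (fun i => rnorm2 (row i A))).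
Qed.

Lemma col_le_norm m n (A : 'M[R]_(m, n)) j : \sum_i A i j ^+ 2 <= norm_12 A ^+ 2.
Proof.
rewrite -norm_2inf_tr; apply: le_trans (row_le_norm _ j).
by rewrite dotE; apply: ler_sum => i _; rewrite !mxE expr2.
Qed.

Lemma norm_2inf_le m n (A : 'M[R]_(m, n)) c : 0 <= c ->
  (forall i, dot (row i A) (row i A) <= c ^+ 2) -> norm_2inf A <= c.
Proof.
move=> c0 Ac; apply: bigmax_le => // i _.
by rewrite -(@ler_pXn2r _ 2) ?nnegrE ?rnorm2_ge0 // rnorm2_sqr.
Qed.

Lemma norm_12_le m n (A : 'M[R]_(m, n)) c : 0 <= c ->
  (forall j, \sum_i A i j ^+ 2 <= c ^+ 2) -> norm_12 A <= c.
Proof.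
move=> c0 Ac; rewrite -norm_2inf_tr norm_2inf_le // => j.
by apply: le_trans (Ac j); rewrite dotE; apply: ler_sum => i _; rewrite !mxE expr2.
Qed.

Definition factor_values m n (A : 'M[R]_(m, n)) : set R :=
  [set x : R | exists (k : nat) (L : 'M[R]_(m, k)) (M : 'M[R]_(k, n)),
         L *m M = A /\ x = norm_2inf L * norm_12 M].

Lemma factor_values_inf m n (A : 'M[R]_(m, n)) : has_inf (factor_values A).
Proof.
split; first by exists (norm_2inf A * norm_12 (1%:M : 'M_n)), n, A, 1%:M; rewrite mulmx1.
by exists 0 => _ [k [L [M [_ ->]]]]; rewrite mulr_ge0 ?norm_2inf_ge0 ?norm_12_ge0.
Qed.

Lemma gamma2_le m n (A : 'M[R]_(m, n)) k (L : 'M_(m, k)) (M : 'M_(k, n)) :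
  L *m M = A -> gamma2 A <= norm_2inf L * norm_12 M.
Proof.
by move=> LM; apply: ge_inf; [case: (factor_values_inf A)|exists k, L, M].
Qed.

Lemma gamma2_ge m n (A : 'M[R]_(m, n)) c :
  (forall k (L : 'M_(m, k)) (M : 'M_(k, n)), L *m M = A ->
    c <= norm_2inf L * norm_12 M) -> c <= gamma2 A.
Proof.
move=> cA; apply: lb_le_inf; first by case: (factor_values_inf A).
by move=> _ [k [L [M [LM ->]]]]; apply: cA.
Qed.

Lemma gamma2_ge0 m n (A : 'M[R]_(m, n)) : 0 <= gamma2 A.
Proof.
by apply: gamma2_ge => k L M _; rewrite mulr_ge0 ?norm_2inf_ge0 ?norm_12_ge0.
Qed.

Lemma mulmx_dot m k n (L : 'M[R]_(m, k)) (M : 'M_(k, n)) i j :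
  (L *m M) i j = dot (row i L) (row j M^T).
Proof. by rewrite mxE dotE; apply: eq_bigr => l _; rewrite !mxE. Qed.

Lemma entry_le_gamma2 m n (A : 'M[R]_(m, n)) i j : `|A i j| <= gamma2 A.
Proof.
apply: gamma2_ge => k L M LM.
have p0 : 0 <= norm_2inf L * norm_12 M.
  by rewrite mulr_ge0 ?norm_2inf_ge0 ?norm_12_ge0.
rewrite -(@ler_pXn2r _ 2) ?nnegrE // real_normK ?num_real //.
rewrite -LM mulmx_dot exprMn; apply: le_trans (dot_CS _ _) _.
rewrite ler_pM ?dot_ge0 ?row_le_norm // -norm_2inf_tr; exact: row_le_norm.
Qed.

Lemma gamma2_rows m m' n (A : 'M[R]_(m, n)) (B : 'M_(m', n)) (f : 'I_m' -> 'I_m) :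
  (forall i j, B i j = A (f i) j) -> gamma2 B <= gamma2 A.
Proof.
move=> BA; apply: gamma2_ge => k L M LM.
apply: le_trans (gamma2_le (_ : (\matrix_i row (f i) L) *m M = B)) _.
  by apply/matrixP => i j; rewrite BA -LM !mulmx_dot rowK.
rewrite ler_wpM2r ?norm_12_ge0 // norm_2inf_le ?norm_2inf_ge0 // => i.
by rewrite rowK row_le_norm.
Qed.

Lemma gamma2_tr m n (A : 'M[R]_(m, n)) : gamma2 A^T <= gamma2 A.
Proof.
apply: gamma2_ge => k L M LM.
apply: le_trans (gamma2_le (_ : M^T *m L^T = A^T)) _; first by rewrite -LM trmx_mul.
by rewrite norm_2inf_tr mulrC -norm_2inf_tr trmxK.
Qed.

Lemma row_mx_of_rows n (qs : seq 'rV[R]_n) (i : 'I_(size qs)) :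
  row i (mx_of_rows qs) = nth 0 qs i.
Proof. by apply/rowP => j; rewrite !mxE. Qed.

(** [gamma2] is an infimum, so a factorization of value at most [2 g] is used; this 2 is the source
    of the 4 in [dominates]. *)
Lemma gamma2_dominated N (qs : seq 'rV[R]_N) g : 0 < g ->
  gamma2 (mx_of_rows qs) <= g -> dominated [seq g^-1 *: q | q <- qs].
Proof.
move=> g0 Qg.
have [_ [k [L [M [LM ->]]]]] := inf_adherent g0 (factor_values_inf (mx_of_rows qs)).
rewrite -/(gamma2 _) => /ltW ab.
have {}ab : norm_2inf L * norm_12 M <= 2 * g by apply: le_trans ab _; lra.
set a := norm_2inf L in ab; set b := norm_12 M in ab.
have a0 : 0 <= a by apply: norm_2inf_ge0.
have b0 : 0 <= b by apply: norm_12_ge0.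
(* The norm [a] of the left factor moves into the right one, whose columns then have norm at most
   [a b / (2 g) <= 1]. *)
exists k, ((a / (2 * g)) *: M); split=> [j|_ /mapP[q /(nthP 0)[i iq <-] ->] w].
  apply: (@le_trans _ _ ((a * b / (2 * g)) ^+ 2)); last first.
    have g2 : 0 < 2 * g by rewrite mulr_gt0.
    rewrite exprn_ile1 ?divr_ge0 ?mulr_ge0 ?(ltW g0) //.
    by rewrite ler_pdivrMr // mul1r.
  rewrite mulrAC exprMn; under eq_bigr do rewrite mxE exprMn.
  by rewrite -mulr_sumr ler_wpM2l ?sqr_ge0 // col_le_norm.
rewrite linearZ /= -scalemxAr dotZl !dotZr dotZl exprMn.
have -> : dot (nth 0 qs i) w = dot (row (Ordinal iq) L) (w *m M^T).
  rewrite -(row_mx_of_rows (Ordinal iq)) -LM row_mul.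
  by rewrite dot_mulr.
have CS := dot_CS (row (Ordinal iq) L) (w *m M^T).
have rL := row_le_norm L (Ordinal iq).
set d := dot (w *m M^T) _ in CS *; have d0 : 0 <= d by apply: dot_ge0.
have {}CS : dot (row (Ordinal iq) L) (w *m M^T) ^+ 2 <= a ^+ 2 * d.
  by apply: le_trans CS _; rewrite ler_wpM2r.
apply: le_trans (ler_wpM2l (sqr_ge0 _) CS) _.
rewrite le_eqVlt; apply/orP; left; apply/eqP; field.
by rewrite gt_eqF.
Qed.

Lemma qform_mx n (s : seq 'rV[R]_n) w :
  qform s w = dot (w *m (mx_of_rows s)^T) (w *m (mx_of_rows s)^T).
Proof.
rewrite /qform (big_nth 0) big_mkord dotE; apply: eq_bigr => i _.
rewrite mul_col_dot dotC expr2.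
by have -> : (col i (mx_of_rows s)^T)^T = nth 0 s i by apply/rowP => j; rewrite !mxE.
Qed.

Lemma qform_mx_cols n (s : seq 'cV[R]_n) w :
  qform [seq r^T | r <- s] w = dot (w *m mx_of_cols s) (w *m mx_of_cols s).
Proof.
rewrite /qform big_map (big_nth 0) big_mkord dotE; apply: eq_bigr => i _.
rewrite mul_col_dot dotC expr2.
by have -> : (col i (mx_of_cols s))^T = (nth 0 s i)^T by apply/rowP => j; rewrite !mxE.
Qed.

End Gamma2.

(** * Weights sharing the column budget *)

Section Weights.
Variables (R : realType) (d : R).
Hypothesis d0 : 0 < d.

(* The telescoping form makes the weights sum to at most 1. *)
Definition weight (i : nat) : R := powR i.+1%:R (- d) - powR i.+2%:R (- d).

Lemma sum_weight n : \sum_(i < n) weight i <= 1.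
Proof.
rewrite -(big_mkord xpredT weight); under eq_bigr do rewrite /weight -opprB.
rewrite sumrN (telescope_sumr (fun i => powR i.+1%:R (- d))) // opprB.
by rewrite powR1 gerBl powR_ge0.
Qed.

(** With [x = i + 1] and [y = i + 2] the weight is [y^(-d) (e^(d (ln y - ln x)) - 1)]; use
    [e^s >= 1 + s] and [ln y - ln x >= 1 / y]. *)
Lemma weight_ge i : d * powR i.+2%:R (- (1 + d)) <= weight i.
Proof.
have y0 : 0 < i.+2%:R :> R by rewrite ltr0n.
have x0 : 0 < i.+1%:R :> R by rewrite ltr0n.
rewrite /weight /powR !gt_eqF //.
set x := i.+1%:R in x0 *; set y := i.+2%:R in y0 *.
have xy : y = x + 1 by rewrite /x /y natr1.
have lnxy : y^-1 <= ln y - ln x.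
  have : ln (1 + (x / y - 1)) <= x / y - 1.
    by apply: le_ln1Dx; rewrite ltrBDr addNr divr_gt0.
  rewrite addrC subrK lnM ?posrE ?invr_gt0 // lnV ?posrE //.
  have -> : x / y = 1 - y^-1 by rewrite -[x](addrK 1) -xy mulrBl divff ?gt_eqF // mul1r.
  by move: (y^-1) (ln x) (ln y) => a b c ?; lra.
have -> : - (1 + d) * ln y = - d * ln y + - ln y by ring.
rewrite expRD expRN lnK ?posrE //.
have -> : - d * ln x = - d * ln y + d * (ln y - ln x) by ring.
rewrite expRD; set e := expR (- d * ln y).
have e0 : 0 < e by apply: expR_gt0.
have h := expR_ge1Dx (d * (ln y - ln x)).
have h2 : d * y^-1 <= d * (ln y - ln x) by rewrite ler_pM2l.
rewrite mulrCA -[X in _ - X]mulr1 -mulrBr ler_pM2l // lerBrDl.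
exact: le_trans (lerD (lexx 1) h2) h.
Qed.

Lemma weight_gt0 i : 0 < weight i.
Proof.
by apply: lt_le_trans (weight_ge i); rewrite mulr_gt0 // powR_gt0 // ltr0n.
Qed.

End Weights.

(** * Powers of two against the logarithm *)

Section Logarithm.
Variable R : realType.

Lemma ln2_ge : 2^-1 <= ln (2 : R).
Proof.
rewrite -(expRK 2^-1) ler_ln ?posrE ?expR_gt0 //.
have h := expR_ge1Dx (- 2^-1 : R).
rewrite expRN in h; have e0 := expR_gt0 (2^-1 : R).
have : expR 2^-1 * (1 + - 2^-1) <= expR 2^-1 * (expR (2^-1 : R))^-1.
  by rewrite ler_pM2l.
by rewrite mulfV ?gt_eqF //; lra.
Qed.

Lemma exp2_le_ln (i : nat) (x : R) : 2 ^+ i <= x -> i%:R <= 2 * ln x.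
Proof.
move=> ix; have p0 : 0 < 2 ^+ i :> R by rewrite exprn_gt0.
have : ln (2 ^+ i) <= ln x by rewrite ler_ln ?posrE // (lt_le_trans p0).
rewrite lnXn // -[ln 2 *+ i]mulr_natr => h1.
have h2 : 2^-1 * i%:R <= ln 2 * i%:R :> R by rewrite ler_wpM2r ?ln2_ge.
by move: (ln x) (ln 2 * i%:R) h1 h2 => a b ? ?; lra.
Qed.

Lemma trunc_log_le_logp N : (trunc_log 2 N).+1%:R <= 2 * logp (N%:R : R).
Proof.
rewrite /logp -natr1; case: N => [|N].
  (* At [N = 0] both logarithms take the value 0. *)
  by rewrite ln0 //; rewrite trunc_log0; lra.
have := @exp2_le_ln (trunc_log 2 N.+1) N.+1%:R.
rewrite -natrX ler_nat trunc_logP // => /(_ isT); lra.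
Qed.

End Logarithm.

(** * Doubling guesses *)


Section Stages.
Variables (R : realType) (N : nat).
Implicit Types (qs h : seq 'rV[R]_N) (q w : 'rV[R]_N).

Local Notation "'e_ j" := (delta_mx 0 j : 'rV[R]_N) (at level 8, j at level 2).

Definition gam qs : R := gamma2 (mx_of_rows qs).

Definition nonzero qs := has (fun q => q != 0) qs.

(** The unit of the guesses. Leading zero rows are skipped; when all rows vanish the default row
    makes it 0. *)
Definition base qs : R := rnorm_inf (nth 0 qs (find (fun q => q != 0) qs)).

Lemma entry_le_rnorm_inf (q : 'rV[R]_N) j : `|q 0 j| <= rnorm_inf q.
Proof. exact: (le_bigmax _ (fun j => `|q 0 j|)). Qed.

Lemma rnorm_inf_gt0 (q : 'rV[R]_N) : q != 0 -> 0 < rnorm_inf q.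
Proof.
move=> q0; rewrite ltNge; apply: contra q0 => le0.
apply/eqP/rowP => j; apply/eqP; rewrite mxE -normr_le0; apply: le_trans le0.
exact: entry_le_rnorm_inf.
Qed.

Lemma base_gt0 qs : nonzero qs -> 0 < base qs.
Proof. by move=> nz; apply: rnorm_inf_gt0; apply: (nth_find 0 nz). Qed.

Lemma base_rcons h q : nonzero h -> base (rcons h q) = base h.
Proof.
by move=> nz; rewrite /base -cats1 find_cat -/(nonzero h) nz nth_cat -has_find -/(nonzero h) nz.
Qed.

Lemma nonzero_rcons h q : nonzero h -> nonzero (rcons h q).
Proof. by rewrite /nonzero has_rcons orbC => ->. Qed.

Lemma gam_prefix h1 h2 : gam h1 <= gam (h1 ++ h2).
Proof.
have sz : (size h1 <= size (h1 ++ h2))%N by rewrite size_cat leq_addr.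
apply: (gamma2_rows (f := widen_ord sz)) => i j.
by rewrite !mxE /= nth_cat ltn_ord.
Qed.

Lemma base_le_gam qs : nonzero qs -> base qs <= gam qs.
Proof.
move=> nz; rewrite /base; have := nz; rewrite /nonzero has_find => fs.
apply: bigmax_le => [|j _]; first exact: gamma2_ge0.
by apply: le_trans (entry_le_gamma2 (mx_of_rows qs) (Ordinal fs) j); rewrite mxE.
Qed.

Lemma gam0 qs : ~~ nonzero qs -> gam qs = 0.
Proof.
move=> nz; apply/eqP; rewrite eq_le gamma2_ge0 andbT.
have -> : gam qs = gamma2 (0 : 'M[R]_(size qs, N)).
  congr gamma2; apply/matrixP => i j; rewrite !mxE.
  have := nz; rewrite -all_predC => /allP/(_ _ (mem_nth 0 (ltn_ord i))) /=.
  by rewrite negbK => /eqP ->; rewrite mxE.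
apply: le_trans (gamma2_le (mul0mx _ (0 : 'M_(0, N)))) _.
rewrite [norm_2inf _](_ : _ = 0) ?mul0r //; apply/eqP; rewrite eq_le norm_2inf_ge0 andbT.
by apply: norm_2inf_le => // i; rewrite row0 dot0l expr0n.
Qed.

Lemma rnorm_inf_ge0 (q : 'rV[R]_N) : 0 <= rnorm_inf q.
Proof.
by rewrite /rnorm_inf; elim/big_ind: _ => // x y x0 _; rewrite le_max x0.
Qed.

Lemma stage_ex qs : exists i : nat, gam qs <= base qs * 2 ^+ i.
Proof.
have [nz|nz] := boolP (nonzero qs); last first.
  by exists 0%N; rewrite gam0 // mulr1 rnorm_inf_ge0.
have b0 := base_gt0 nz.
exists (Num.truncn (gam qs / base qs)).+1; rewrite mulrC -ler_pdivrMr //.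
apply: le_trans (ltW (truncnS_gt _)) _.
by rewrite -natrX ler_nat ltnW // ltn_expl.
Qed.

Definition stage qs : nat := ex_minn (stage_ex qs).

Definition guess qs : R := base qs * 2 ^+ stage qs.

Lemma gam_le_guess qs : gam qs <= guess qs.
Proof. by rewrite /guess /stage; case: ex_minnP. Qed.

(** By minimality of the stage, the previous guess was too small; at stage 0 the guess is
    [base qs]. *)
Lemma guess_le qs : nonzero qs -> guess qs <= 2 * gam qs.
Proof.
move=> nz; rewrite /guess /stage; case: ex_minnP => -[|i] _ imin.
  by have := base_le_gam nz; have := gamma2_ge0 (mx_of_rows qs); rewrite -/(gam qs) mulr1; lra.
have := imin i; rewrite ltnn => imin'.
have : ~~ (gam qs <= base qs * 2 ^+ i) by apply/negP => /imin'.
by rewrite -ltNge exprS; lra.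
Qed.

Lemma guess_gt0 qs : nonzero qs -> 0 < guess qs.
Proof. by move=> nz; rewrite mulr_gt0 ?base_gt0 ?exprn_gt0. Qed.

Lemma stage_rcons h q : nonzero h -> (stage h <= stage (rcons h q))%N.
Proof.
move=> nz; rewrite {1}/stage; case: ex_minnP => i _; apply.
rewrite -(base_rcons q nz); apply: le_trans (gam_le_guess _).
by rewrite -cats1 gam_prefix.
Qed.

(** * Concatenating the runs for successive guesses *)

Variables (f : seq 'rV[R]_N -> seq 'rV[R]_N) (D V : R) (sc : R -> nat -> R).
Hypothesis f_app : forall qs q, exists s, f (rcons qs q) = f qs ++ s.
Hypothesis f_le : forall qs j, dominated qs -> qform (f qs) 'e_j <= D.
Hypothesis f_cov : forall qs q w, dominated (rcons qs q) ->
  dot q w ^+ 2 <= V * qform (f (rcons qs q)) w.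
Hypothesis sc_gt0 : forall b i, 0 < b -> 0 < sc b i.
Hypothesis V0 : 0 <= V.
Hypothesis D0 : 0 <= D.

Definition scaled (i : nat) qs := [seq (base qs * 2 ^+ i)^-1 *: q | q <- qs].

(** A run with the [i]-th guess replays the entire history; [sc] sets its share of the norm
    budget. *)
Definition phase i qs := [seq sc (base qs) i *: r | r <- f (scaled i qs)].

Definition incr h : seq 'rV[R]_N :=
  let h' := take (size h).-1 h in
  if ~~ nonzero h then [::]
  else if nonzero h' && (stage h' == stage h) then
    drop (size (phase (stage h) h')) (phase (stage h) h)
  else phase (stage h) h.

Definition acc qs t := flatten [seq incr (take s qs) | s <- iota 1 t].

Lemma acc_take qs t : (t <= size qs)%N -> acc (take t qs) t = acc qs t.
Proof.
move=> tq; congr flatten; apply/eq_in_map => s; rewrite mem_iota => /andP[_ st].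
by rewrite take_takel // -ltnS -add1n.
Qed.

Lemma acc_rcons h q : acc (rcons h q) (size h).+1 = acc h (size h) ++ incr (rcons h q).
Proof.
rewrite /acc -(addn1 (size h)) iotaD map_cat flatten_cat add1n /= cats0; congr (_ ++ _).
  congr flatten; apply/eq_in_map => s; rewrite mem_iota => /andP[_ st].
  by rewrite -cats1 takel_cat // -ltnS -add1n.
by rewrite -(size_rcons h q) take_size.
Qed.

Lemma scaled_rcons i h q : nonzero h ->
  scaled i (rcons h q) = rcons (scaled i h) ((base h * 2 ^+ i)^-1 *: q).
Proof. by move=> nz; rewrite /scaled base_rcons // map_rcons. Qed.

Lemma scaled_dominated h : nonzero h -> dominated (scaled (stage h) h).
Proof.
by move=> nz; apply: gamma2_dominated (guess_gt0 nz) (gam_le_guess h).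
Qed.

Lemma phase_le h j : nonzero h ->
  qform (phase (stage h) h) 'e_j <= sc (base h) (stage h) ^+ 2 * D.
Proof.
move=> nz; rewrite qform_scale ler_wpM2l ?sqr_ge0 //.
exact/f_le/scaled_dominated.
Qed.

Lemma phase_rcons i h q : nonzero h -> exists s, phase i (rcons h q) = phase i h ++ s.
Proof.
move=> nz; rewrite /phase scaled_rcons // base_rcons //.
have [s ->] := f_app (scaled i h) ((base h * 2 ^+ i)^-1 *: q).
by rewrite map_cat; eexists.
Qed.

Lemma acc_zero h : ~~ nonzero h -> acc h (size h) = [::].
Proof.
elim/last_ind: h => // h q IH nz; rewrite size_rcons acc_rcons IH.
  by rewrite /incr nz.
by apply: contra nz; apply: nonzero_rcons.
Qed.

(** An abandoned run is charged at its last state under a valid guess, at most [sc ^ 2 * D]; skipped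
    stages only add nonnegative terms. *)
Lemma acc_bounds h : nonzero h ->
  (forall w, qform (phase (stage h) h) w <= qform (acc h (size h)) w) /\
  (forall j, qform (acc h (size h)) 'e_j <=
    \sum_(i < stage h) (sc (base h) i ^+ 2 * D) + qform (phase (stage h) h) 'e_j).
Proof.
elim/last_ind: h => // h q IH nz; rewrite size_rcons acc_rcons.
have -> : incr (rcons h q) = if nonzero h && (stage h == stage (rcons h q)) then
    drop (size (phase (stage (rcons h q)) h)) (phase (stage (rcons h q)) (rcons h q))
    else phase (stage (rcons h q)) (rcons h q).
  by rewrite /incr nz size_rcons /= -[X in take _ X]cats1 take_size_cat.
have [nzh|nzh] /= := boolP (nonzero h); last first.
  rewrite acc_zero //; split=> // j.
  by rewrite lerDr sumr_ge0 // => i _; rewrite mulr_ge0 ?sqr_ge0.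
have [IH1 IH2] := IH nzh; rewrite base_rcons //.
have [<-|neq] := eqVneq (stage h) (stage (rcons h q)).
  have [s ->] := phase_rcons (stage h) q nzh.
  rewrite drop_size_cat //; split=> [w|j]; rewrite !qform_cat.
    by rewrite lerD2r.
  by rewrite addrA lerD2r.
split=> [w|j]; rewrite qform_cat; first by rewrite lerDr qform_ge0.
have lt_st : (stage h < stage (rcons h q))%N by rewrite ltn_neqAle neq stage_rcons.
rewrite lerD2r; apply: le_trans (IH2 j) _.
apply: (@le_trans _ _ (\sum_(i < (stage h).+1) sc (base h) i ^+ 2 * D)).
  by rewrite big_ord_recr /= lerD2l phase_le.
rewrite -!(big_mkord xpredT (fun i => sc (base h) i ^+ 2 * D)).
rewrite (@big_cat_nat _ _ _ (stage h).+1 0 (stage (rcons h q))) //= lerDl.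
by rewrite sumr_ge0 // => i _; rewrite mulr_ge0 ?sqr_ge0.
Qed.

Lemma acc_le h j : nonzero h -> qform (acc h (size h)) 'e_j <=
  \sum_(i < (stage h).+1) (sc (base h) i ^+ 2 * D).
Proof.
move=> nz; apply: le_trans ((acc_bounds nz).2 j) _.
by rewrite big_ord_recr /= lerD2l phase_le.
Qed.

(** The current run lies in [acc]; undoing the two scalings costs [guess ^ 2 / sc ^ 2]. *)
Lemma acc_cover h w : dot (last 0 h) w ^+ 2 <=
  V * guess h ^+ 2 / sc (base h) (stage h) ^+ 2 * qform (acc h (size h)) w.
Proof.
have [nz|nz] := boolP (nonzero h); last first.
  have -> : last 0 h = 0.
    case: h nz => // x h nz; apply/eqP; apply: contraNT nz => nl.
    by apply/hasP; exists (last x h); rewrite ?mem_last.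
  rewrite dot0l expr0n mulr_ge0 ?qform_ge0 // divr_ge0 ?sqr_ge0 // mulr_ge0 //.
  exact: sqr_ge0.
case/lastP: h nz => // h q nz; rewrite last_rcons.
have b0 := base_gt0 nz; have s0 := sc_gt0 (stage (rcons h q)) b0.
have g0 := guess_gt0 nz.
have dom := scaled_dominated nz.
have := (acc_bounds nz).1 w; rewrite qform_scale.
have : dot ((guess (rcons h q))^-1 *: q) w ^+ 2
    <= V * qform (f (scaled (stage (rcons h q)) (rcons h q))) w.
  by move: dom; rewrite /scaled map_rcons; apply: f_cov.
rewrite dotZl exprMn exprVn.
set s := sc _ _ in s0 *; set g := guess _ in g0 *; set x := qform _ w; set y := qform _ w.
move=> h1 h2; have s2 : 0 < s ^+ 2 by rewrite exprn_gt0.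
have g2 : 0 < g ^+ 2 by rewrite exprn_gt0.
rewrite ler_pdivrMl // in h1; apply: le_trans h1 _.
have xy : x <= y / s ^+ 2 by rewrite ler_pdivlMr // mulrC.
have -> : V * g ^+ 2 / s ^+ 2 * y = g ^+ 2 * (V * (y / s ^+ 2)).
  by rewrite mulrA (mulrC (g ^+ 2)) !mulrA (mulrAC _ y).
by rewrite ler_pM2l // ler_wpM2l.
Qed.

End Stages.

(** * The two arrival models *)


Section Algorithms.
Variable R : realType.

Lemma row_coeff N (s : seq 'rV[R]_N) q c : 0 <= c ->
  (forall w, dot q w ^+ 2 <= c * qform s w) ->
  exists l : seq R, [/\ size l = size s,
    rv_of_seq (size s) l *m mx_of_rows s = q
    & dot (rv_of_seq (size s) l) (rv_of_seq (size s) l) <= c].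
Proof.
move=> c0 qs; have [w|v [vM vc]] := @coeff_exists R _ _ (mx_of_rows s) q c c0.
  by rewrite -qform_mx.
exists [seq v 0 i | i <- enum 'I_(size s)].
have -> : rv_of_seq (size s) [seq v 0 i | i <- enum 'I_(size s)] = v.
  by apply/rowP => i; rewrite mxE (nth_map i) ?nth_ord_enum // size_enum_ord.
by rewrite size_map size_enum_ord.
Qed.

Lemma col_coeff m (s : seq 'cV[R]_m) a c : 0 <= c ->
  (forall w, dot a^T w ^+ 2 <= c * qform [seq r^T | r <- s] w) ->
  exists l : seq R, [/\ size l = size s,
    mx_of_cols s *m cv_of_seq (size s) l = a
    & \sum_i cv_of_seq (size s) l i 0 ^+ 2 <= c].
Proof.
move=> c0 qs; have [w|v [vM vc]] := @coeff_exists R _ _ (mx_of_cols s)^T a^T c c0.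
  by rewrite trmxK -qform_mx_cols.
exists [seq v 0 i | i <- enum 'I_(size s)].
have -> : cv_of_seq (size s) [seq v 0 i | i <- enum 'I_(size s)] = v^T.
  by apply/colP => i; rewrite !mxE (nth_map i) ?nth_ord_enum // size_enum_ord.
rewrite size_map size_enum_ord; split=> //.
  by rewrite -[LHS]trmxK trmx_mul trmxK vM trmxK.
apply: le_trans vc; rewrite dotE; apply: ler_sum => i _.
by rewrite mxE expr2.
Qed.

Lemma sum_col_mx_of_rows N (s : seq 'rV[R]_N) j :
  \sum_i mx_of_rows s i j ^+ 2 = qform s (delta_mx 0 j).
Proof.
rewrite /qform (big_nth 0) big_mkord; apply: eq_bigr => i _.
by rewrite mxE dot_delta.
Qed.

Lemma sum_row_mx_of_cols m (s : seq 'cV[R]_m) i :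
  dot (row i (mx_of_cols s)) (row i (mx_of_cols s))
  = qform [seq r^T | r <- s] (delta_mx 0 i).
Proof.
rewrite dotE /qform big_map (big_nth 0) big_mkord; apply: eq_bigr => j _.
by rewrite !mxE dot_delta !mxE expr2.
Qed.

Lemma gam_take N (qs : seq 'rV[R]_N) t : gam (take t qs) <= gam qs.
Proof. by rewrite -{2}(cat_take_drop t qs) gam_prefix. Qed.

Lemma last_take N (qs : seq 'rV[R]_N) t : (0 < t <= size qs)%N ->
  last 0 (take t qs) = nth 0 qs t.-1.
Proof.
case: t => // t /andP[_ tq]; rewrite -nth_last size_takel //= nth_take //.
Qed.

(** At stage [i + 1] minimality gives [2^i <= x / base h], so [i + 3 <= 3 + 2 ln (x / base h)]. *)
Lemma stage_le_log N (h : seq 'rV[R]_N) x : nonzero h -> gam h <= x ->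
  (stage h).+2%:R <= 3 * logp (x / base h).
Proof.
move=> nz hx; have b0 := base_gt0 nz.
have : 2 ^+ stage h <= 2 * (x / base h).
  rewrite mulrA ler_pdivlMr // mulrC; apply: le_trans (guess_le nz) _.
  by rewrite ler_pM2l.
move=> /exp2_le_ln.
have x1 : 1 <= x / base h.
  by rewrite ler_pdivlMr // mul1r; apply: le_trans (base_le_gam nz) hx.
have l0 := ln_ge0 x1.
case E : (stage h) => [|i] _; first by rewrite /logp; lra.
have : 2 ^+ i <= x / base h.
  have := guess_le nz; rewrite /guess E exprS => g2.
  rewrite ler_pdivlMr // mulrC; apply: le_trans hx; lra.
move=> /exp2_le_ln; rewrite /logp -!natr1.
by move: (ln _) l0 i%:R => a ? b ?; lra.
Qed.

(** * The row arrival model *)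

Section RowArrival.
Variable c : R.
Hypothesis c0 : 0 < c.

Lemma row_arrival : exists C : R, 0 < C /\
  forall N : nat, exists A : row_alg R N,
    row_alg_valid A /\
    forall qs : seq 'rV[R]_N, qs != [::] -> nth 0 qs 0 != 0 ->
      let Q := mx_of_rows qs in
      row_alg_achieves A qs
        (C * gamma2 Q
           * powR (logp (gamma2 Q / rnorm_inf (nth 0 qs 0))) (2^-1 + c)
           * logp N%:R ^+ 3).
Proof.
(* The inverse weight grows with exponent [1 + d], whose half is [1/2 + c]. *)
pose d := 2 * c; have d0 : 0 < d by rewrite mulr_gt0.
pose p3 : R := powR 3 (2^-1 + c).
have p30 : 0 < p3 by apply: powR_gt0.
(* [656 = 41 * 8 * 2]: [41^2] exceeds [16 * 104] from [V * D], 8 comes from [t <= 2 * logp N], and 2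
   from [guess_le]. [p3] absorbs the 3 of [stage_le_log]. *)
pose C := 656 * p3 / Num.sqrt d.
have sd : 0 < Num.sqrt d by rewrite sqrtr_gt0.
have C0 : 0 < C by rewrite divr_gt0 // mulr_gt0.
exists C; split=> // N.
have [f [f_app f_le f_cov]] := core_algorithm R N.
pose t : R := (trunc_log 2 N).+1%:R; rewrite -/t in f_le f_cov.
have t1 : 1 <= t by rewrite ler1n.
set D := 104 * t ^+ 3 in f_le; set V := 16 * t ^+ 3 in f_cov.
have D0 : 0 < D by rewrite mulr_gt0 // exprn_gt0 // (lt_le_trans ltr01).
have V0 : 0 < V by rewrite mulr_gt0 // exprn_gt0 // (lt_le_trans ltr01).
(* Run [i] then has diagonal at most [weight d i], and the weights sum to at most 1. *)
pose sc (b : R) i := Num.sqrt (weight d i / D).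
have w0 i : 0 < weight d i by apply: weight_gt0.
have sc2 b i : sc b i ^+ 2 = weight d i / D by rewrite sqr_sqrtr // divr_ge0 // ltW.
have sc0 b i : 0 < b -> 0 < sc b i by move=> _; rewrite sqrtr_gt0 divr_gt0.
pose cost (h : seq 'rV[R]_N) := V * guess h ^+ 2 / sc (base h) (stage h) ^+ 2.
pose Rs h := acc f sc h (size h).
have cost0 h : 0 <= cost h by rewrite divr_ge0 ?sqr_ge0 // mulr_ge0 ?sqr_ge0 // ltW.
have coeff_ex (h : seq 'rV[R]_N) : exists l : seq R, [/\ size l = size (Rs h),
    rv_of_seq (size (Rs h)) l *m mx_of_rows (Rs h) = last 0 h
    & dot (rv_of_seq (size (Rs h)) l) (rv_of_seq (size (Rs h)) l) <= cost h].
  apply: row_coeff => // w.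
  exact: (acc_cover f_app f_le f_cov sc0 (ltW V0) (ltW D0)).
have [l lP] := boolp.choice coeff_ex.
pose A := RowAlg [::] (fun h => (incr f sc h, l h)).
have RE qs s : (s <= size qs)%N -> ra_R A qs s = Rs (take s qs).
  by move=> sq; rewrite /Rs size_takel // acc_take.
exists A; split=> [qs s /andP[s0 sq] /=|qs _ q0 Q s /andP[s0 sq]].
  rewrite RE // /ra_l /=; have [l1 l2 l3] := lP (take s qs).
  split=> //; first by rewrite l2 last_take // s0.
  apply: norm_12_le => // j; rewrite sum_col_mx_of_rows expr1n.
  have [nz|nz] := boolP (nonzero (take s qs)); last first.
    by rewrite /Rs acc_zero // qform_nil.
  apply: le_trans (acc_le sc f_app f_le (ltW D0) j nz) _.
  under eq_bigr do rewrite sc2 divfK ?gt_eqF //.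
  exact: sum_weight.
rewrite RE // /ra_l /=; have [_ _ l3] := lP (take s qs).
set h := take s qs in l3 *.
have nz : nonzero h.
  rewrite /h; case: qs q0 {Q sq h l3} => [|q qs] /=; first by rewrite eqxx.
  by case: s s0 => //= s _ ->.
have bq : base h = rnorm_inf (nth 0 qs 0).
  rewrite /base /h; case: qs q0 {Q sq h l3 nz} => [|q qs] /=; first by rewrite eqxx.
  by case: s s0 => //= s _ ->.
have hQ : gam h <= gamma2 Q by apply: gam_take.
have b0 := base_gt0 nz.
have g0 : 0 <= gamma2 Q by apply: gamma2_ge0.
have slog := stage_le_log nz hQ; rewrite bq in slog.
set x := logp (_ / _) in slog *; set y := logp _.
have x0 : 0 < x by move: slog; rewrite -!natr1; have := ler0n R (stage h); lra.
have ty : t <= 2 * y by apply: trunc_log_le_logp.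
have y0 : 0 < y by lra.
pose P := powR x (2^-1 + c).
have P0 : 0 < P by apply: powR_gt0.
have bound0 : 0 <= C * gamma2 Q * P * y ^+ 3.
  by rewrite mulr_ge0 ?exprn_ge0 ?(ltW y0) // mulr_ge0 ?(ltW P0) // mulr_ge0 // ltW.
rewrite -(@ler_pXn2r _ 2) ?nnegrE ?rnorm2_ge0 // rnorm2_sqr.
apply: le_trans l3 _; rewrite /cost sc2.
have inv_weight : d * (weight d (stage h))^-1 <= (p3 * P) ^+ 2.
  apply: (@le_trans _ _ (powR (stage h).+2%:R (1 + d))).
    rewrite ler_pdivrMr // -(@ler_pM2r _ (powR (stage h).+2%:R (- (1 + d)))).
      rewrite [leRHS]mulrAC -powRD.
        rewrite subrr powRr0 mul1r; exact: weight_ge.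
      by apply/implyP => _; rewrite gt_eqF // ltr0n.
    by rewrite powR_gt0 // ltr0n.
  rewrite -powRM ?(ltW x0) // -powR_mulrn ?powR_ge0 // -powRrM.
  have -> : (2^-1 + c) * 2%:R = 1 + d by rewrite /d; field.
  apply: ge0_ler_powR; rewrite ?nnegrE ?ler0n ?mulr_ge0 ?(ltW x0) //.
  by rewrite addr_ge0 // ltW.
have gx : guess h ^+ 2 <= (2 * gamma2 Q) ^+ 2.
  rewrite ler_pXn2r ?nnegrE ?(ltW (guess_gt0 nz)) ?mulr_ge0 //.
  by apply: le_trans (guess_le nz) _; rewrite ler_pM2l.
have t3 : V * D <= 1664 * (2 * y) ^+ 6.
  have -> : V * D = 1664 * t ^+ 6 by rewrite /V /D; ring.
  by rewrite ler_pM2l // ler_pXn2r ?nnegrE //; lra.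
have -> : V * guess h ^+ 2 / (weight d (stage h) / D)
    = (V * D) * guess h ^+ 2 * (d * (weight d (stage h))^-1) / d.
  by field; rewrite !gt_eqF.
have -> : (C * gamma2 Q * P * y ^+ 3) ^+ 2
    = (1681 * (2 * y) ^+ 6) * (2 * gamma2 Q) ^+ 2 * (p3 * P) ^+ 2 / d.
  rewrite /C -[in RHS](sqr_sqrtr (ltW d0)); field.
  by rewrite gt_eqF.
rewrite ler_pM2r ?invr_gt0 //; apply: ler_pM => //.
- by rewrite mulr_ge0 ?sqr_ge0 // mulr_ge0 ?(ltW V0) ?(ltW D0).
- by rewrite mulr_ge0 ?invr_ge0 ?(ltW d0) ?(ltW (w0 _)).
apply: ler_pM => //; rewrite ?sqr_ge0 ?(mulr_ge0 (ltW V0) (ltW D0)) //.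
apply: le_trans t3 _; rewrite ler_wpM2r ?exprn_ge0 ?mulr_ge0 ?(ltW y0) //.
by rewrite ler_nat.
Qed.

End RowArrival.

(** * The column arrival model, by transposition *)

Lemma gam_tr m (as_ : seq 'cV[R]_m) :
  gam [seq a^T | a <- as_] <= gamma2 (mx_of_cols as_).
Proof.
apply: le_trans (gamma2_tr (mx_of_cols as_)).
have sz : size [seq a^T | a <- as_] = size as_ by rewrite size_map.
apply: (gamma2_rows (f := cast_ord sz)) => i j.
by rewrite !mxE (nth_map 0) ?mxE // -sz.
Qed.

Lemma sum_pow4_le n : \sum_(i < n.+1) (2 ^+ i) ^+ 2 <= 2 * (2 ^+ n) ^+ 2 :> R.
Proof.
elim: n => [|n IH]; first by rewrite big_ord1 !expr0 expr1n; lra.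
rewrite big_ord_recr /= [2 ^+ n.+1]exprS; have := sqr_ge0 (2 ^+ n : R).
by move: IH; set x := 2 ^+ n; set y := \sum_(i < _) _ => IH; nra.
Qed.

Lemma col_arrival : exists C : R, 0 < C /\
  forall m : nat, exists A : col_alg R m,
    col_alg_valid A /\
    forall as_ : seq 'cV[R]_m,
      col_alg_value A as_ <= C * gamma2 (mx_of_cols as_) * logp m%:R ^+ 3.
Proof.
(* [984 = 41 * 8 * 3], as in the row model except for 3: the squared guesses sum to at most twice
   the last one squared, so to at most [8 gamma2^2 <= (3 gamma2)^2]. *)
exists 984; split=> // m.
have [f [f_app f_le f_cov]] := core_algorithm R m.
pose t : R := (trunc_log 2 m).+1%:R; rewrite -/t in f_le f_cov.
have t1 : 1 <= t by rewrite ler1n.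
set D := 104 * t ^+ 3 in f_le; set V := 16 * t ^+ 3 in f_cov.
have D0 : 0 < D by rewrite mulr_gt0 // exprn_gt0 // (lt_le_trans ltr01).
have V0 : 0 < V by rewrite mulr_gt0 // exprn_gt0 // (lt_le_trans ltr01).
(* This makes the cover cost [V * guess ^ 2 / sc ^ 2] at most 1, as [r_t] requires. *)
pose sc (b : R) i := b * 2 ^+ i * Num.sqrt V.
have sc0 b i : 0 < b -> 0 < sc b i.
  by move=> b0; rewrite !mulr_gt0 ?exprn_gt0 ?sqrtr_gt0.
have scE b i : sc b i ^+ 2 = b ^+ 2 * (2 ^+ i) ^+ 2 * V.
  by rewrite !exprMn sqr_sqrtr // ltW.
pose rows (as_ : seq 'cV[R]_m) := [seq a^T | a <- as_].
pose Ls as_ := [seq r^T | r <- acc f sc (rows as_) (size as_)].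
have LsK as_ : [seq r^T | r <- Ls as_] = acc f sc (rows as_) (size (rows as_)).
  by rewrite /Ls size_map -map_comp map_id_in // => r _ /=; rewrite trmxK.
have coeff_ex (h : seq 'cV[R]_m) : exists l : seq R, [/\ size l = size (Ls h),
    mx_of_cols (Ls h) *m cv_of_seq (size (Ls h)) l = last 0 h
    & \sum_i cv_of_seq (size (Ls h)) l i 0 ^+ 2 <= 1].
  apply: col_coeff => // w; rewrite LsK mul1r.
  have -> : (last 0 h)^T = last 0 (rows h).
    by rewrite -[in RHS](trmx0 R m 1) last_map.
  apply: le_trans (acc_cover f_app f_le f_cov sc0 (ltW V0) (ltW D0) _ w) _.
  rewrite -[leRHS]mul1r ler_wpM2r ?qform_ge0 // scE.
  rewrite /guess exprMn [X in _ / X]mulrC; set z := V * _.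
  (* When all columns vanish the guess is 0 and the quotient is 0, not 1. *)
  have [-> | zN] := eqVneq z 0; first by rewrite mul0r ler01.
  by rewrite divff.
have [l lP] := boolp.choice coeff_ex.
pose A := ColAlg [::] (fun h => ([seq r^T | r <- incr f sc (rows h)], l h)).
have LE as_ s : (s <= size as_)%N -> ca_L A as_ s = Ls (take s as_).
  move=> sq; rewrite /Ls size_takel // /rows map_take acc_take ?size_map //.
  rewrite /ca_L /= /acc map_flatten -map_comp; congr flatten.
  by apply: eq_map => u /=; rewrite /rows map_take.
exists A; split=> [as_ s /andP[s0 sq] /=|as_].
  rewrite LE // /ca_r /=; have [l1 l2 l3] := lP (take s as_).
  split=> //.
    rewrite l2; case: s s0 sq {l1 l2 l3} => // s _ sq.
    by rewrite -nth_last size_takel //= nth_take.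
  rewrite -(@ler_pXn2r _ 2) ?nnegrE ?sqrtr_ge0 // expr1n sqr_sqrtr //.
  by rewrite sumr_ge0 // => i _; rewrite sqr_ge0.
rewrite /col_alg_value LE // take_size.
have g0 : 0 <= gamma2 (mx_of_cols as_) by apply: gamma2_ge0.
have ty : t <= 2 * logp m%:R by apply: trunc_log_le_logp.
set y := logp _ in ty *; have y0 : 0 < y by lra.
apply: norm_2inf_le => [|i]; first by rewrite !mulr_ge0 // ?exprn_ge0 // ltW.
rewrite sum_row_mx_of_cols LsK.
have [nz|nz] := boolP (nonzero (rows as_)); last first.
  by rewrite acc_zero // qform_nil sqr_ge0.
apply: le_trans (acc_le sc f_app f_le (ltW D0) i nz) _.
set b := base _; set n := stage _.
have -> : \sum_(k < n.+1) sc b k ^+ 2 * D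
    = (V * D) * (b ^+ 2 * \sum_(k < n.+1) (2 ^+ k) ^+ 2).
  rewrite !mulr_sumr; apply: eq_bigr => k _; rewrite scE; ring.
have gx : b ^+ 2 * \sum_(k < n.+1) (2 ^+ k) ^+ 2 <= (3 * gamma2 (mx_of_cols as_)) ^+ 2.
  apply: le_trans (ler_wpM2l (sqr_ge0 b) (sum_pow4_le n)) _.
  rewrite mulrCA -exprMn -/(guess (rows as_)).
  have h1 := le_trans (guess_le nz) (ler_wpM2l (ler0n R 2) (gam_tr as_)).
  have h2 := guess_gt0 nz.
  move: (guess _) (gamma2 _) g0 h1 h2 => u v v0 uv u0; nra.
have t3 : V * D <= 1664 * (2 * y) ^+ 6.
  have -> : V * D = 1664 * t ^+ 6 by rewrite /V /D; ring.
  by rewrite ler_pM2l // ler_pXn2r ?nnegrE //; lra.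
apply: le_trans (ler_pM _ _ t3 gx) _.
- by rewrite mulr_ge0 ?(ltW V0) ?(ltW D0).
- by rewrite mulr_ge0 ?sqr_ge0 // sumr_ge0 // => k _; rewrite sqr_ge0.
have -> : 984 * gamma2 (mx_of_cols as_) * y ^+ 3
  = 41 * (2 * y) ^+ 3 * (3 * gamma2 (mx_of_cols as_)) by ring.
rewrite [leRHS]exprMn ler_wpM2r ?sqr_ge0 // [leRHS]exprMn -exprM.
by rewrite ler_wpM2r ?exprn_ge0 ?mulr_ge0 ?(ltW y0) // -natrX ler_nat.
Qed.

End Algorithms.

Theorem theorem1p5 (R : realType) :
  (forall c : R, 0 < c ->
     exists C : R, 0 < C /\
     forall N : nat, exists A : row_alg R N,
       row_alg_valid A /\
       forall qs : seq 'rV[R]_N, qs != [::] -> nth 0 qs 0 != 0 ->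
         let Q := mx_of_rows qs in
         row_alg_achieves A qs
           (C * gamma2 Q
              * powR (logp (gamma2 Q / rnorm_inf (nth 0 qs 0))) (2^-1 + c)
              * logp N%:R ^+ 3))
  /\
  (exists C : R, 0 < C /\
     forall m : nat, exists A : col_alg R m,
       col_alg_valid A /\
       forall as_ : seq 'cV[R]_m,
         col_alg_value A as_ <= C * gamma2 (mx_of_cols as_) * logp m%:R ^+ 3).
Proof. by split; [exact: row_arrival | exact: col_arrival]. Qed.
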